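(* For a finite simple graph $G$ the following statements are equivalent: (1) $G$ admits a $\{{}^bP_3,{}^rP_3,{}^bK_3,{}^{rbb}K_3\}$-free $2$-edge-colouring. (2) $G$ admits a $\{{}^bP_3,{}^rP_3,{}^rK_3,{}^{rrb}K_3\}$-free $2$-edge-colouring. (3) Each connected component of $G$ is either a line graph of an incidence graph or a diamond. (4) $G$ is a $\{\text{claw}, 4\text{-wheel}, \text{gem}, \text{kite}, X_1, X_2, K_5-e, \text{odd-hole}, \text{even-butterfly}\}$-free graph.
   Context: Graphs are finite and simple. A $2$-edge-colouring of $G$ assigns to every edge the colour red or blue (not necessarily properly). For a set $\mathcal F$ of $2$-edge-coloured graphs, a $2$-edge-colouring of $G$ is $\mathcal F$-free if no induced $2$-edge-coloured subgraph is isomorphic (preserving colours) to a member of $\mathcal F$. Patterns on three vertices: ${}^rP_3$ (resp. ${}^bP_3$) is the path on three vertices with both edges red (resp. blue); ${}^rK_3$ (resp. ${}^bK_3$) is the triangle with all edges red (resp. blue); ${}^{rrb}K_3$ is the triangle with two red and one blue edge; ${}^{rbb}K_3$ is the triangle with one red and two blue edges. The line graph of $H$ has vertex set $E(H)$, two vertices being adjacent iff the corresponding edges share an endpoint. A graph is an incidence graph if it is bipartite with a bipartition $(X,Y)$ in which every vertex of $X$ has degree at most $2$. For uncoloured graphs, being free of a set of graphs means containing no induced subgraph isomorphic to a member. Claw: $K_{1,3}$. Diamond: $K_4$ minus an edge. $4$-wheel: join of $C_4$ and $K_1$. Gem: join of $P_4$ and $K_1$. Kite: diamond plus a new vertex adjacent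 to exactly one vertex of the diamond, which has degree $2$ in the diamond. $X_1$: diamond plus a new vertex adjacent to exactly the two vertices of degree $2$ of the diamond. $X_2$: diamond plus a new vertex adjacent to both vertices of degree $3$ and to exactly one vertex of degree $2$ of the diamond. $K_5-e$: $K_5$ minus one edge. An odd-hole is a chordless cycle of odd length at least $5$. For $n\ge 0$, the $n$-butterfly consists of two triangles joined by a path of length $n$ (one vertex of each triangle is an end of the path; for $n=0$ the two triangles share exactly one vertex). An even-butterfly is a $2n$-butterfly for some $n\ge 0$. *)

(* Defs.v *)
(* World: Mathematical Components. *)
From mathcomp Require Import all_boot.
Set Implicit Arguments.
Unset Strict Implicit.
Unset Printing Implicit Defensive.

Record sgraph := SGraph {
  vertex :> finType;
  adj : rel vertex;
  adj_sym : symmetric adj;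
  adj_irr : irreflexive adj }.

Definition graph_iso (G H : sgraph) : Prop :=
  exists2 f : G -> H, bijective f & {mono f : x y / adj x y}.

Definition neighbours (G : sgraph) (x : G) : {set G} := [set y | adj x y].

Definition degree (G : sgraph) (x : G) : nat := #|neighbours x|.

Definition edges (G : sgraph) : {set {set G}} :=
  [set [set p.1; p.2] | p in [pred p : G * G | adj p.1 p.2]].

Definition edge (G : sgraph) : finType := {e : {set G} | e \in edges G}.

Section Induced.
Variables (G : sgraph) (A : {set G}).

Let iadj : rel {x : G | x \in A} := fun x y => adj (val x) (val y).

Fact induced_sym : symmetric iadj.
Proof. by move=> x y; exact: adj_sym. Qed.

Fact induced_irr : irreflexive iadj.
Proof. by move=> x; exact: adj_irr. Qed.

Definition induced : sgraph := SGraph induced_sym induced_irr.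

Fact induced_edge_subproof (e : edge induced) :
  [set val x | x in val e] \in edges G.
Proof.
have /imsetP[[x y] /= xy ->] := valP e.
by apply/imsetP; exists (val x, val y); rewrite ?imsetU1 ?imset_set1.
Qed.

Definition induced_edge (e : edge induced) : edge G :=
  exist (fun f => f \in edges G) _ (induced_edge_subproof e).

End Induced.

(* [F] is a set of graphs. *)
Definition free (F : sgraph -> Prop) (G : sgraph) : Prop :=
  forall H : sgraph, F H -> ~ exists A : {set G}, graph_iso (induced A) H.

Variant colour := Red | Blue.

Record cgraph := CGraph {
  cgraph_graph :> sgraph;
  edge_colour : edge cgraph_graph -> colour }.

Definition cgraph_iso (G H : cgraph) : Prop :=
  exists f : G -> H,
    [/\ bijective f,
        {mono f : x y / adj x y} &
        forall (e : edge G) (e' : edge H),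
          val e' = [set f x | x in val e] -> edge_colour e' = edge_colour e].

Definition cinduced (G : cgraph) (A : {set G}) : cgraph :=
  @CGraph (induced A) (fun e => edge_colour (induced_edge e)).

Definition cfree (F : cgraph -> Prop) (G : cgraph) : Prop :=
  forall H : cgraph, F H -> ~ exists A : {set G}, cgraph_iso (cinduced A) H.

Definition has_free_colouring (F : cgraph -> Prop) (G : sgraph) : Prop :=
  exists c : edge G -> colour, cfree F (CGraph c).

Definition components (G : sgraph) : {set {set G}} :=
  equivalence_partition (connect (@adj G)) [set: G].

Section LineGraph.
Variable H : sgraph.

Let ladj : rel (edge H) :=
  fun e f => (e != f) && (val e :&: val f != set0).

Fact line_sym : symmetric ladj.
Proof. by move=> e f; rewrite /ladj eq_sym setIC. Qed.

Fact line_irr : irreflexive ladj.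
Proof. by move=> e; rewrite /ladj eqxx. Qed.

Definition line_graph : sgraph := SGraph line_sym line_irr.

End LineGraph.

(* The parts of a bipartition are allowed to be empty. *)
Definition bipartition (H : sgraph) (X Y : {set H}) : Prop :=
  [/\ X :|: Y = setT, [disjoint X & Y],
      {in X &, forall x y, ~~ adj x y} & {in Y &, forall x y, ~~ adj x y}].

Definition incidence_graph (H : sgraph) : Prop :=
  exists X Y : {set H}, bipartition X Y /\ {in X, forall x, degree x <= 2}.

Definition line_of_incidence (G : sgraph) : Prop :=
  exists2 H : sgraph, incidence_graph H & graph_iso G (line_graph H).

Section GraphOf.
Variables (T : finType) (r : rel T).

(* The graph on [T] obtained from [r] by dropping loops and orientations. *)
Let radj : rel T := fun x y => (x != y) && (r x y || r y x).

Fact graph_of_sym : symmetric radj.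
Proof. by move=> x y; rewrite /radj eq_sym orbC. Qed.

Fact graph_of_irr : irreflexive radj.
Proof. by move=> x; rewrite /radj eqxx. Qed.

Definition graph_of : sgraph := SGraph graph_of_sym graph_of_irr.

End GraphOf.

Definition complete_graph (n : nat) : sgraph :=
  graph_of (fun _ _ : 'I_n => true).

Definition edgeless_graph (n : nat) : sgraph :=
  graph_of (fun _ _ : 'I_n => false).

(* [n] is the number of vertices. *)
Definition path_graph (n : nat) : sgraph :=
  graph_of (fun i j : 'I_n => j == i.+1 :> nat).

(* This is the cycle of length [n] only for [n >= 3]. *)
Definition cycle_graph (n : nat) : sgraph :=
  graph_of (fun i j : 'I_n => j == i.+1 %% n :> nat).

Definition join (G H : sgraph) : sgraph :=
  graph_of (fun u v : G + H =>
    match u, v with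
    | inl x, inl y => adj x y
    | inr x, inr y => adj x y
    | _, _ => true
    end).

Definition delete_edge (G : sgraph) (a b : G) : sgraph :=
  graph_of (fun x y : G => adj x y && ([set x; y] != [set a; b])).

(* [None] is the new vertex, with neighbourhood [N]. *)
Definition add_vertex (G : sgraph) (N : {set G}) : sgraph :=
  graph_of (fun u v : option G =>
    match u, v with
    | Some x, Some y => adj x y
    | None, Some y => y \in N
    | _, None => false
    end).

Definition mono_P3 (c : colour) : cgraph :=
  @CGraph (path_graph 3) (fun=> c).

Definition mono_K3 (c : colour) : cgraph :=
  @CGraph (complete_graph 3) (fun=> c).

(* The edge joining vertices 0 and 1 has colour [d], the other two have
   colour [c]. *)
Definition mixed_K3 (c d : colour) : cgraph :=
  @CGraph (complete_graph 3)
    (fun e => if val e == [set inord 0; inord 1] :> {set 'I_3} then d else c).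

Definition rP3 := mono_P3 Red.
Definition bP3 := mono_P3 Blue.
Definition rK3 := mono_K3 Red.
Definition bK3 := mono_K3 Blue.
Definition rrbK3 := mixed_K3 Red Blue.
Definition rbbK3 := mixed_K3 Blue Red.

Definition claw : sgraph := join (complete_graph 1) (edgeless_graph 3).

Definition diamond : sgraph :=
  @delete_edge (complete_graph 4) (inord 0) (inord 1).

(* Vertices 0 and 1 of the diamond have degree 2, vertices 2 and 3 have
   degree 3. *)
Definition dv (i : nat) : diamond := inord i : 'I_4.

Definition four_wheel : sgraph := join (cycle_graph 4) (complete_graph 1).
Definition gem : sgraph := join (path_graph 4) (complete_graph 1).
Definition kite : sgraph := add_vertex [set dv 0].
Definition X1 : sgraph := add_vertex [set dv 0; dv 1].
Definition X2 : sgraph := add_vertex [set dv 2; dv 3; dv 0].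
Definition K5_minus_e : sgraph :=
  @delete_edge (complete_graph 5) (inord 0) (inord 1).

(* The triangles are {0, 1, 2} and {n + 2, n + 3, n + 4}, and they are joined
   by the path 2, 3, ..., n + 2 of length n. *)
Definition butterfly (n : nat) : sgraph :=
  graph_of (fun i j : 'I_(n + 5) =>
    [|| j == i.+1 :> nat,
        (i == 0 :> nat) && (j == 2 :> nat) |
        (i == n.+2 :> nat) && (j == n.+4 :> nat)]).

Inductive forbidden : sgraph -> Prop :=
| forbidden_claw : forbidden claw
| forbidden_four_wheel : forbidden four_wheel
| forbidden_gem : forbidden gem
| forbidden_kite : forbidden kite
| forbidden_X1 : forbidden X1
| forbidden_X2 : forbidden X2
| forbidden_K5_minus_e : forbidden K5_minus_e
| forbidden_odd_hole (n : nat) :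
    odd n -> 5 <= n -> forbidden (cycle_graph n)
| forbidden_even_butterfly (n : nat) : forbidden (butterfly n.*2).

(* Main.v *)
Require Import Defs.
From mathcomp Require Import all_boot.
From mathcomp Require Import zify.
From Stdlib Require Import Classical_Prop.
Set Implicit Arguments.
Unset Strict Implicit.
Unset Printing Implicit Defensive.

(* Statements (1) and (2) are exchanged by swapping the colours. Calling blue
   the colour that may occur at most once in a triangle, each of them says that
   [G] has a matching (the blue edges) containing an edge of every induced path
   on three vertices: a [good] relation.

   A minimal good matching of a connected graph either leaves a transitive red
   relation, and the graph is then the line graph of the incidence graph between
   blue classes and red cliques, or contains a blue edge closing a red path on
   three vertices; this forces an induced diamond, all of whose vertices are
   matched inside it, so that the diamond is the whole component. The same
   remark excludes the good matchings of the forbidden graphs containing a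
   diamond; in odd holes and even butterflies blue and red alternate and parity
   is violated.

   Conversely, let a connected forbidden-free graph contain no diamond (with a
   diamond, it is one). Consecutive edges of an induced path on three vertices
   must get different colours, and edges of triangles must be red. Hence the
   only obstruction is a walk of odd length, alternating along induced paths on
   three vertices, between two edges that must both be red. A shortest such walk
   is an induced path, since a shortest chord closes an odd hole or gives a
   shortcut. Between triangles it is therefore an even butterfly. So the edges
   of triangles extend to a maximal set of edges not joined by odd walks, and
   its complement is a good matching. *)

(** * Alternating walks in claw- and diamond-free graphs *)

Definition far (G : sgraph) (x y : G) := (x != y) && ~~ adj x y.

Lemma far_sym (G : sgraph) : symmetric (@far G).
Proof. by move=> x y; rewrite /far eq_sym adj_sym. Qed.

Lemma farPn (G : sgraph) (x y : G) : ~~ far x y -> x = y \/ adj x y.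
Proof. by rewrite negb_and !negbK => /orP[/eqP|]; [left|right]. Qed.

Lemma adj_far (G : sgraph) (x y : G) : adj x y -> far x y -> False.
Proof. by move=> xy /andP[_]; rewrite xy. Qed.

Lemma set2_inj (T : finType) (a b c d : T) : [set a; b] = [set c; d] ->
  a = c /\ b = d \/ a = d /\ b = c.
Proof.
move=> E; have := set21 a b; have := set22 a b; rewrite E !inE.
have := set21 c d; have := set22 c d; rewrite -E !inE.
by do 4![case/pred2P=> ?]; subst; auto.
Qed.

(* [lia] case-splits on every boolean hypothesis in sight. *)
Ltac arith := repeat match goal with
  | H : is_true (adj _ _) |- _ => clear H
  | H : is_true (far _ _) |- _ => clear H
  | H : is_true (_ \in _) |- _ => clear H
  | H : is_true (_ \notin _) |- _ => clear H
  end; lia.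

Lemma maximal_set (T : finType) (P : {set T} -> Prop) (A : {set T}) : P A ->
  exists B : {set T}, [/\ A \subset B, P B & forall x, x \notin B -> ~ P (x |: B)].
Proof.
have [n] := ubnP #|~: A|; elim: n A => // n IH A An PA.
have [[x [xA Px]]|max] := classic (exists x, x \notin A /\ P (x |: A)).
  have /IH/(_ Px)[B [AB PB max]] : #|~: (x |: A)| < n.
    rewrite setCU setIC -setDE; move: An; rewrite (cardsD1 x (~: A)) inE xA.
    by rewrite add1n ltnS.
  by exists B; split=> //; apply: subset_trans AB; apply: subsetUr.
by exists A; split=> // x xA Px; apply: max; exists x.
Qed.

Definition good (G : sgraph) (m : rel G) :=
  [/\ symmetric m, forall x y, m x y -> adj x y,
      forall x y z, m x y -> m x z -> y = z &
      forall x y z, adj x y -> adj y z -> far x z -> m x y || m y z].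

Section Walks.
Variable G : sgraph.
Implicit Types (u v w : nat -> G) (x y z : G).

(* The length [k] counts steps between consecutive edges v_iv_(i+1), which
   must alternate in colour: there are k + 2 vertices. *)
Definition walk v k :=
  (forall i, i <= k -> adj (v i) (v i.+1)) /\
  (forall i, i < k -> far (v i) (v i.+2)).

Lemma walk_rev v k : walk v k -> walk (fun i => v (k.+1 - i)) k.
Proof.
case=> A F; split=> i ik.
  rewrite adj_sym.
  by have := A (k - i); rewrite subSS subSn //; apply; apply: leq_subr.
have -> : k.+1 - i = (k - i.+1).+2 by arith.
by rewrite subSS far_sym; apply: F; arith.
Qed.

Lemma walk_take v k l : walk v k -> l <= k -> walk v l.
Proof. by case=> A F lk; split=> i il; [apply: A | apply: F]; arith. Qed.

Lemma walk_shift v k l : walk v k -> l <= k -> walk (fun i => v (l + i)) (k - l).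
Proof.
by case=> A F lk; split=> i il; rewrite ?addnS; [apply: A | apply: F]; arith.
Qed.

Lemma walk_join v k w l : walk v k -> walk w l -> v k = w 0 -> v k.+1 = w 1 ->
  walk (fun i => if i <= k then v i else w (i - k)) (k + l).
Proof.
move=> [Av Fv] [Aw Fw] E0 E1.
have E i : k <= i -> (if i <= k then v i else w (i - k)) = w (i - k).
  by case: (ltngtP i k) => // -> _; rewrite subnn.
have E' i : i <= k.+1 -> (if i <= k then v i else w (i - k)) = v i.
  case: (leqP i k) => // ki ik; have -> : i = k.+1 by arith.
  by rewrite subSnn.
split=> i il.
  have [ik|ik] := ltnP i k; first by rewrite !E'; [apply: Av|..]; arith.
  by rewrite !E ?(leqW ik) // subSn //; apply: Aw; arith.
have [ik|ik] := ltnP i k; first by rewrite !E'; [apply: Fv|..]; arith.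
by rewrite !E ?subSn; [apply: Fw|..]; arith.
Qed.

Lemma walk3 x y z : adj x y -> adj y z -> far x z -> walk (nth x [:: x; y; z]) 1.
Proof. by move=> xy yz xz; split; [case=> [|[|]] | case]. Qed.

Hypothesis claw_free : forall x a b c,
  adj x a -> adj x b -> adj x c -> far a b -> far a c -> far b c -> False.

Lemma third_neighbour x a b c : adj x a -> adj x b -> adj x c ->
  far a b -> far a c -> b = c \/ adj b c.
Proof.
move=> xa xb xc ab ac; apply: farPn; apply/negP=> bc.
exact: (claw_free xa xb xc ab ac bc).
Qed.

Hypothesis odd_hole_free : forall n u, odd n -> 5 <= n ->
  (forall i j, i < j -> j < n ->
     if (j == i.+1) || (i == 0) && (j == n.-1) then adj (u i) (u j)
     else far (u i) (u j)) -> False.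

Definition triangle_closed (S : {set {set G}}) :=
  forall x y z, adj x y -> adj x z -> adj y z -> [set x; y] \in S.

Section Shortest.
Variable S : {set {set G}}.
Hypothesis triS : triangle_closed S.

Definition odd_walk v k :=
  [/\ odd k, walk v k, [set v 0; v 1] \in S & [set v k; v k.+1] \in S].

Definition shortest v k :=
  odd_walk v k /\ forall w l, l < k -> ~ odd_walk w l.

Lemma odd_walk_rev v k : odd_walk v k -> odd_walk (fun i => v (k.+1 - i)) k.
Proof.
case=> ok wv s0 sk; split => //; first exact: walk_rev.
  by rewrite subn0 subSS subn0 setUC.
by rewrite subSnn subnn setUC.
Qed.

Lemma odd_walk_join v k w l : odd (k + l) -> walk v k -> walk w l ->
  v k = w 0 -> v k.+1 = w 1 ->
  [set v 0; v 1] \in S -> [set w l; w l.+1] \in S ->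
  odd_walk (fun i => if i <= k then v i else w (i - k)) (k + l).
Proof.
move=> okl wv ww E0 E1 s0 sl; split=> //; first exact: walk_join.
  by case: k E0 E1 {wv okl} => [|k] E0 E1 //=; rewrite -E1.
case: l sl {okl ww} => [|l] sl; last first.
  rewrite !ifF; [|lia|lia].
  by rewrite subSn ?leq_addr // addKn.
by rewrite addn0 leqnn ltnn subSnn E0.
Qed.

Lemma shortest_rev v k : shortest v k -> shortest (fun i => v (k.+1 - i)) k.
Proof. by case=> /odd_walk_rev. Qed.

Lemma shortest_inner v k i :
  shortest v k -> 0 < i < k -> [set v i; v i.+1] \notin S.
Proof.
move=> [[ok wv s0 sk] min] /andP[i0 ik]; apply/negP => si.
case oi: (odd i).
  by apply: (min v i ik); split=> //; apply: walk_take wv (ltnW ik).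
apply: (min (fun j => v (i + j)) (k - i)); first by arith.
split; first by rewrite oddB ?ok ?oi // ltnW.
- by apply: walk_shift => //; apply: ltnW.
- by rewrite addn0 addn1.
by rewrite addnS subnKC ?(ltnW ik).
Qed.

Lemma shortest3 v k x y z : shortest v k -> 1 < k ->
  adj x y -> adj y z -> far x z ->
  [set x; y] \in S -> [set y; z] \in S -> False.
Proof.
move=> [_ min] k1 xy yz xz sxy syz.
by apply: (min (nth x [:: x; y; z]) 1 k1); split=> //; apply: walk3.
Qed.

(* Cutting the loop out preserves the parity. *)
Lemma shortest_loop v k i j : shortest v k -> i < j <= k -> ~~ odd (j - i) ->
  v i = v j -> v i.+1 = v j.+1 -> False.
Proof.
move=> [[ok wv s0 sk] min] /andP[ij jk] oji E0 E1.
apply: (min _ (i + (k - j)) _); last apply: (@odd_walk_join v i (fun l => v (j + l))).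
- by lia.
- by lia.
- by apply: walk_take wv _; lia.
- exact: walk_shift.
- by rewrite addn0.
- by rewrite addn1.
- exact: s0.
by rewrite addnS subnKC.
Qed.

Section Chord.
Variables (v : nat -> G) (k : nat).
Hypothesis short : shortest v k.

Lemma shortest_chord0 d : odd d -> 2 < d <= k ->
  (forall i e, 1 < e < d -> i + e <= k.+1 -> far (v i) (v (i + e))) ->
  adj (v 0) (v d) -> False.
Proof.
move=> od /andP[d2 dk] farv a0d.
have [[ok [A F] s0 sk] min] := short.
have k1 : 1 < k by arith.
have f1d : far (v 1) (v d).
  by have := farv 1 d.-1; rewrite add1n prednK; [apply; arith | arith].
have Sd0 : [set v d; v 0] \in S -> False.
  move=> sd0; apply: (shortest3 short k1 _ (A 0 (leq0n _)) _ sd0 s0).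
    by rewrite adj_sym.
  by rewrite far_sym.
have f0p : far (v d.-1) (v 0).
  by have := farv 0 d.-1; rewrite add0n far_sym; apply; arith.
have adp : adj (v d) (v d.-1)
  by rewrite adj_sym; have := A d.-1; rewrite prednK; [apply; arith|arith].
have fpd : far (v d.-1) (v d.+1).
  by have := F d.-1; rewrite prednK; [apply; arith|arith].
have ad0 : adj (v d) (v 0) by rewrite adj_sym.
case: (third_neighbour adp ad0 (A d dk) f0p fpd) => [E|a]; last first.
  by apply: Sd0; apply: triS ad0 (A d dk) a.
have [dk'|dk'] := eqVneq d k; first by apply: Sd0; rewrite E dk'.
have fd2 : far (v d) (v d.+2) by apply: F; arith.
have a2 : adj (v 0) (v d.+2) by rewrite E; apply: A; arith.
have sd : [set v d.+1; v d.+2] \in S -> False.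
  by apply/negP; apply: (shortest_inner short); arith.
have f1d' : far (v d) (v 1) by rewrite far_sym.
case: (third_neighbour a0d (A 0 isT) a2 f1d' fd2) => [E'|a].
  by apply: sd; rewrite -E -E'.
by apply: sd; rewrite -E; apply: (triS a2 (A 0 isT)); rewrite adj_sym.
Qed.

End Chord.

Lemma shortest_induced v k i j : shortest v k -> i.+1 < j -> j <= k.+1 ->
  far (v i) (v j).
Proof.
move=> short.
suff farv d : 1 < d -> forall i, i + d <= k.+1 -> far (v i) (v (i + d)).
  by move=> ij jk; rewrite -(subnKC (ltnW (ltnW ij))); apply: farv; arith.
have [[ok [A F] s0 sk] min] := short.
elim/ltn_ind: d {i j} => d IH d1 i le_idk.
have [->|d2] := eqVneq d 2; first by rewrite addn2; apply: F; arith.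
have {}d2 : 2 < d by arith.
have far1 : far (v i) (v (i + d.-1)) by apply: IH; arith.
have ajp : adj (v (i + d)) (v (i + d.-1)).
  by rewrite adj_sym; have := A (i + d.-1); rewrite -addnS prednK; [apply; arith|arith].
apply: contraT => /farPn[E|aij].
  by case: (adj_far ajp); rewrite -E.
have od : odd d.
  apply: contraT => od; exfalso; apply: (@odd_hole_free d.+1 (fun a => v (i + a))).
  - by [].
  - by case: d d1 d2 od {IH le_idk far1 ajp aij} => [|[|[|[|]]]].
  move=> a b ab bd; case: eqP => [->|ab'] /=; first by rewrite addnS; apply: A; arith.
  case: ifP => [/andP[/eqP-> /eqP->]|ab'']; first by rewrite addn0.
  have -> : i + b = i + a + (b - a) by arith.
  apply: IH; [|arith|arith].
  by have [/eqP a0|a0] := boolP (a == 0); move: ab''; rewrite ?a0 //=; arith.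
exfalso.
have [i0|i0] := posnP i.
  apply: (@shortest_chord0 v k short d) => //.
  - have : d != k.+1 by apply: contraTneq od => ->; rewrite /= ok.
    by arith.
  - by move=> l e /andP[e1 ed]; apply: IH.
  by move: aij; rewrite i0.
have [jk|jk] := eqVneq (i + d) k.+1.
  apply: (@shortest_chord0 _ k (shortest_rev short) d) => //.
  - by arith.
  - move=> l e /andP[e1 ed] le.
    have -> : k.+1 - l = (k.+1 - (l + e)) + e by arith.
    by rewrite far_sym; apply: IH => //; arith.
  by rewrite subn0 -jk addnK adj_sym.
have {}jk : i + d <= k by arith.
have ai : adj (v i) (v i.-1).
  by rewrite adj_sym; have := A i.-1; rewrite prednK //; apply; arith.
have aj := A _ jk.
have ai' : adj (v i) (v i.+1) by apply: A; arith.
have fi : far (v i.+1) (v i.-1).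
  by have := F i.-1; rewrite far_sym prednK //; apply; arith.
have fj : far (v (i + d.-1)) (v (i + d).+1).
  by have := F (i + d.-1); rewrite -addnS prednK; [apply; arith|arith].
have fij : far (v i.+1) (v (i + d)).
  have -> : i + d = i.+1 + d.-1 by arith.
  by apply: IH; arith.
have aji : adj (v (i + d)) (v i) by rewrite adj_sym.
have fji : far (v (i + d.-1)) (v i) by rewrite far_sym.
have i1S : [set v i.-1; v i] \in S -> i = 1.
  move=> si; apply/eqP; rewrite eqn_leq i0 andbT leqNgt; apply/negP=> i1.
  have := @shortest_inner v k i.-1 short; rewrite prednK // si.
  by move=> h; have := h ltac:(arith).
have jkS : [set v (i + d); v (i + d).+1] \in S -> i + d = k.
  move=> sj; apply/eqP; apply: contraTT sj => jk'.
  by apply: (shortest_inner short); arith.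
have par : i = 1 -> i + d = k -> False.
  by move=> -> E; move: ok; rewrite -E add1n /= od.
have [E|a] := third_neighbour ai' ai aij fi fij;
  have [E'|a'] := third_neighbour ajp aj aji fj fji.
- apply: (@shortest_loop v k i.-1 (i + d) short) => //.
  + by arith.
  + have -> : i + d - i.-1 = d.+1 by arith.
    by rewrite /= od.
  by rewrite prednK.
- apply: par; [apply: i1S | apply: jkS].
    by rewrite E; apply: triS aji aj _; rewrite adj_sym.
  by apply: triS aj aji _.
- apply: par; [apply: i1S | apply: jkS].
    by rewrite setUC; apply: triS ai aij a.
  by rewrite E' setUC; apply: triS aij ai _; rewrite adj_sym.
- apply: par; [apply: i1S | apply: jkS].
    by rewrite setUC; apply: triS ai aij a.
  exact: triS aj aji a'.
Qed.

End Shortest.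

Hypothesis diamond_free : forall a b c d : G, far a b -> adj c d ->
  adj a c -> adj a d -> adj b c -> adj b d -> False.

Hypothesis even_butterfly_free : forall n u, ~~ odd n ->
  (forall i j, i < j -> j < n + 5 ->
     if [|| j == i.+1, (i == 0) && (j == 2) | (i == n.+2) && (j == n.+4)]
     then adj (u i) (u j) else far (u i) (u j)) -> False.

Definition triangle_edges : {set {set G}} :=
  [set [set p.1; p.2] | p in [pred p : G * G |
     adj p.1 p.2 && [exists z, adj z p.1 && adj z p.2]]].

Lemma triangle_edgesP x y : reflect
  (adj x y /\ exists2 z, adj z x & adj z y) ([set x; y] \in triangle_edges).
Proof.
apply: (iffP imsetP) => [[[a b] /andP[/= ab /existsP[z /andP[za zb]]]]|].
  by move=> /set2_inj[][-> ->]; split; rewrite // 1?adj_sym //; exists z.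
move=> [xy [z zx zy]]; exists (x, y) => //=; rewrite inE /= xy /=.
by apply/existsP; exists z; rewrite zx.
Qed.

Lemma triangle_edges_closed : triangle_closed triangle_edges.
Proof.
by move=> x y z xy xz yz; apply/triangle_edgesP; split=> //; exists z;
   rewrite adj_sym.
Qed.

Lemma odd_walk_head v k z : odd_walk triangle_edges v k ->
  adj z (v 0) -> adj z (v 1) ->
  odd_walk triangle_edges (fun i => if i == 0 then z else v i) k.
Proof.
move=> [ok [A F] s0 sk] z0 z1.
have k0 : 0 < k by case: k ok {A F sk}.
have a01 : adj (v 0) (v 1) by apply: A.
have a12 : adj (v 1) (v 2) by apply: A.
have f02 : far (v 0) (v 2) by apply: F.
split=> //.
- split=> [[|i] //=|[|i] /=]; [exact: A | move=> _ | exact: F].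
  apply: contraT => /farPn[E|z2].
    by case: (adj_far _ f02); rewrite -E adj_sym.
  exfalso; apply: (diamond_free f02 z1); rewrite 1?adj_sym //.
  by rewrite adj_sym.
- by apply/triangle_edgesP; split=> //=; exists (v 0); rewrite 1?adj_sym // adj_sym.
by case: k k0 sk {ok A F}.
Qed.

Lemma no_odd_triangle_walk k v : ~ odd_walk triangle_edges v k.
Proof.
elim/ltn_ind: k v => k IH v ow.
have ind w : odd_walk triangle_edges w k ->
    forall i j, i.+1 < j -> j <= k.+1 -> far (w i) (w j).
  move=> oww i j; apply: shortest_induced; first exact: triangle_edges_closed.
  by split=> // w' l lk; apply: IH.
have [ok [A _] s0 sk] := ow.
have [_ [z z0 z1]] := triangle_edgesP _ _ s0.
have [_ [t tk tk1]] := triangle_edgesP _ _ sk.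
have owz := odd_walk_head ow z0 z1.
have farz j : 1 < j -> j <= k.+1 -> far z (v j).
  by case: j => // j j1 jk; exact: (ind _ owz 0 j.+1).
have tailE w : odd_walk triangle_edges w k -> w k = v k -> w k.+1 = v k.+1 ->
    forall i, i < k -> far (w i) t.
  move=> oww wk wk1 i ik.
  have := odd_walk_head (odd_walk_rev oww); rewrite subn0 subSS subn0 wk wk1.
  move=> /(_ _ tk1 tk) owt; have := ind _ owt 0 (k.+1 - i).
  rewrite /= ifF ?subKn; [|by arith|by arith].
  by rewrite far_sym; apply; arith.
have fart := tailE v ow erefl erefl.
have farzt : far z t.
  by apply: (tailE _ owz _ _ 0) => //;
     case: k ok {IH ow ind A sk tk tk1 owz farz tailE fart}.
have k0 : 0 < k by case: k ok {IH ow ind A sk tk tk1 owz farz tailE fart}.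
apply: (@even_butterfly_free k.-1 (fun i => if i == 0 then v 0 else
   if i == 1 then z else if i == k + 3 then t else v i.-1)); first by arith.
have -> : k.-1 + 5 = k + 4 by arith.
have -> : k.-1.+4 = k + 3 by arith.
have -> : k.-1.+2 = k.+1 by arith.
have farv := ind v ow.
move=> [|[|i]] [|[|j]] //= ij jk; rewrite ?orbF ?(adj_sym _ z) //=.
- have [->|j0] := eqVneq j 0; first by rewrite ifF; [exact: A | arith].
  rewrite ifF; last by arith.
  by case: ifP => [_|jt]; [exact: fart | apply: farv; arith].
- rewrite (_ : 1 == k.+1 = false) ?orbF; last by arith.
  have [->|j0] := eqVneq j 0; first by rewrite /= ifF //; arith.
  rewrite ifF; last by arith.
  by case: ifP => [_|jt] //; apply: farz; arith.
rewrite (_ : i.+2 == k + 3 = false); last by arith.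
have [jt|jt] := eqVneq j.+2 (k + 3).
  have [ik|ik] := eqVneq i.+2 k.+1.
    by rewrite orbT (_ : i.+1 = k) 1?adj_sym //; arith.
  have [ik'|ik'] := eqVneq j.+2 i.+3.
    by rewrite (_ : i.+1 = k.+1) /= 1?adj_sym //; arith.
  by apply: fart; arith.
rewrite andbF orbF; case: eqP => [[->] | ji]; first by apply: A; arith.
by apply: farv; arith.
Qed.

Section Maximal.
Variable S : {set {set G}}.
Hypothesis triS : triangle_closed S.
Hypothesis no_odd : forall v k, ~ odd_walk S v k.

Lemma reach_parity k l v w : walk v k -> walk w l ->
  [set v 0; v 1] \in S -> [set w 0; w 1] \in S ->
  [set v k; v k.+1] = [set w l; w l.+1] -> ~~ odd (k + l).
Proof.
move=> wv ww sv sw E; apply/negP => okl.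
have [[]|[E0 E1]] := set2_inj E; last first.
  apply: (no_odd (odd_walk_join okl wv (walk_rev ww) _ _ sv _)).
  - by rewrite subn0.
  - by rewrite subSS subn0.
  by rewrite subSnn subnn setUC.
elim: k l w wv ww sw okl {E} => [|k IH] l w wv ww sw okl E0 E1.
  by apply: (no_odd (v := w) (k := l)); split; rewrite -?E0 -?E1.
case: l okl ww E0 E1 => [|l] okl ww E0 E1.
  apply: (no_odd (v := v) (k := k.+1)); split=> //; last by rewrite E0 E1.
  by move: okl; rewrite addn0.
have wv' : walk v k by apply: walk_take wv _.
have ww' : walk w l by apply: walk_take ww _.
have [[A F] [A' F']] := (wv, ww).
have a1 : adj (v k.+1) (v k) by rewrite adj_sym; apply: A.
have a2 : adj (v k.+1) (w l) by rewrite E0 adj_sym; apply: A'.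
have a3 : adj (v k.+1) (v k.+2) by apply: A.
have f1 : far (v k.+2) (v k) by rewrite far_sym; apply: F.
have f2 : far (v k.+2) (w l) by rewrite E1 far_sym; apply: F'.
have [E|a] := third_neighbour a3 a1 a2 f1 f2.
  by apply: (IH l w) => //; move: okl; rewrite addSn addnS /= negbK.
have s1 : [set v k; v k.+1] \in S by rewrite setUC; apply: triS a1 a2 a.
have s2 : [set w l; w l.+1] \in S.
  by rewrite -E0 setUC; apply: triS a2 a1 _; rewrite adj_sym.
have [okk|ekk] := boolP (odd k).
  by apply: (no_odd (v := v) (k := k)).
by apply: (no_odd (v := w) (k := l)); split=> //; arith.
Qed.

Lemma odd_reach_step a b c v k : odd k -> walk v k -> [set v 0; v 1] \in S ->
  [set v k; v k.+1] = [set a; b] -> adj a b -> adj b c -> far a c ->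
  [set b; c] \notin S ->
  exists w l, [/\ ~~ odd l, walk w l, [set w 0; w 1] \in S &
                  [set w l; w l.+1] = [set b; c]].
Proof.
move=> ok wv s0 E ab bc ac sbc; have [[E0 E1]|[E0 E1]] := set2_inj E.
  have wj := walk_join wv (walk3 ab bc ac) E0 E1.
  exists (fun i => if i <= k then v i else nth a [:: a; b; c] (i - k)), k.+1.
  split; first by rewrite /= ok.
  - by rewrite -addn1.
  - by case: k ok {wv E E0 E1 wj}.
  rewrite !ifF; [|lia|lia].
  by rewrite subSnn subSn // subSnn.
have k0 : 0 < k by case: k ok {wv E E0 E1}.
have [A F] := wv.
have bu : adj b (v k.-1).
  by rewrite adj_sym -E0; have := A k.-1; rewrite prednK // leq_pred; apply.
have ba : adj b a by rewrite adj_sym.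
have au : far a (v k.-1).
  by rewrite far_sym -E1; have := F k.-1; rewrite prednK // leqnn; apply.
have [Eu|uc] := third_neighbour ba bu bc au ac; last first.
  by case/negP: sbc; apply: triS bc bu _; rewrite adj_sym.
exists v, k.-1; split=> //.
- by case: k ok k0 {wv s0 E E0 E1 A F bu au Eu}.
- by apply: walk_take wv (leq_pred _).
by rewrite prednK // E0 Eu setUC.
Qed.

Hypothesis maximal : forall e, e \notin S ->
  ~ (forall v k, ~ odd_walk (e |: S) v k).

Lemma odd_reach e : e \notin S -> exists v k,
  [/\ odd k, walk v k, [set v 0; v 1] \in S & [set v k; v k.+1] = e].
Proof.
move=> eS; apply: NNPP => none; case: (maximal eS) => v k; move: v.
elim/ltn_ind: k => k IH v ow.
have ind i j : i.+1 < j -> j <= k.+1 -> far (v i) (v j).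
  apply: (shortest_induced (S := e |: S)); last first.
    by split=> // w l lk; apply: IH.
  by move=> x y z xy xz yz; rewrite inE (triS xy xz yz) orbT.
have [ok wv s0 sk] := ow.
have k0 : 0 < k by case: k ok {IH ow wv sk ind}.
case/setU1P: s0 => s0; case/setU1P: sk => sk; last first.
- exact: (no_odd (v := v) (k := k)).
- by apply: none; exists v, k.
- apply: none; exists (fun i => v (k.+1 - i)), k; split=> //.
  + exact: walk_rev.
  + by rewrite subn0 subSS subn0 setUC.
  by rewrite subSnn subnn setUC.
move: s0; rewrite -sk => /set2_inj[[E _]|[E _]]; last first.
  by have := ind 0 k.+1; rewrite -E /far eqxx ltnS k0 leqnn => /(_ isT isT).
have [k1|k1] := eqVneq k 1.
  by case: wv => /(_ 0 isT); rewrite E k1 adj_irr.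
have : far (v 0) (v k) by apply: ind; lia.
by rewrite E /far eqxx.
Qed.

Lemma maximal_good : good (fun x y => adj x y && ([set x; y] \notin S)).
Proof.
have notboth a b c : adj a b -> adj b c -> far a c ->
    [set a; b] \in S \/ [set b; c] \in S.
  move=> ab bc ac; apply/orP/negPn/negP; rewrite negb_or => /andP[sab sbc].
  have [v [k [ok wv sv E]]] := odd_reach sab.
  have [w [l [ol ww sw E']]] := odd_reach_step ok wv sv E ab bc ac sbc.
  have [u [n [on wu su E'']]] := odd_reach sbc.
  have := reach_parity ww wu sw su; rewrite E' E'' => /(_ erefl).
  by rewrite oddD on (negbTE ol).
split=> [x y|x y /andP[]//|x y z /andP[xy sxy] /andP[xz sxz]|x y z xy yz xz].
- by rewrite adj_sym setUC.
- apply/eqP; apply: contraT => yz.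
  have [yz'|yz'] := boolP (adj y z).
    by case/negP: sxy; apply: triS xy xz yz'.
  have [||||] := notboth y x z; rewrite // 1?adj_sym /far ?yz ?yz' //.
    by rewrite setUC (negbTE sxy).
  by rewrite (negbTE sxz).
rewrite xy yz /= -negb_and; apply/negP => /andP[sxy syz].
by apply: (no_odd (v := nth x [:: x; y; z]) (k := 1)); split=> //; apply: walk3.
Qed.

End Maximal.

Lemma good_of_claw_diamond_free : exists m : rel G, good m.
Proof.
have [S [TS no_odd max]] := maximal_set
  (P := fun S : {set {set G}} => forall v k, ~ odd_walk S v k)
  (fun v k => @no_odd_triangle_walk k v).
exists (fun x y => adj x y && ([set x; y] \notin S)); apply: maximal_good => //.
by move=> x y z xy xz yz; apply: (subsetP TS); apply: triangle_edges_closed yz.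
Qed.

End Walks.

(** * Embeddings and good matchings *)

Definition embedding (H G : sgraph) (h : H -> G) :=
  injective h /\ {mono h : x y / adj x y}.

Lemma embeddingI (H G : sgraph) (h : H -> G) :
  (forall x y, x != y -> if adj x y then adj (h x) (h y) else far (h x) (h y)) ->
  embedding h.
Proof.
move=> E; split=> x y.
  move=> hxy; apply/eqP/contraT => /E; rewrite hxy adj_irr /far eqxx.
  by case: ifP.
have [->|/E] := eqVneq x y; first by rewrite !adj_irr.
by case: (adj x y) => // /andP[_ /negbTE].
Qed.

Lemma embedding_far (H G : sgraph) (h : H -> G) x y :
  embedding h -> far (h x) (h y) = far x y.
Proof. by move=> [i m]; rewrite /far m (inj_eq i). Qed.

Lemma inj_surj_bij (A B : finType) (f : A -> B) :
  injective f -> (forall y, exists x, f x = y) -> bijective f.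
Proof.
move=> inj /fin_all_exists[g fg]; exists g => // x.
by apply: inj; rewrite fg.
Qed.

Lemma surjective_embedding_iso (H G : sgraph) (h : H -> G) :
  embedding h -> (forall y, exists x, h x = y) -> graph_iso G H.
Proof.
move=> [inj mono] surj; have [g hK gK] := inj_surj_bij inj surj.
by exists g; [exists h | move=> x y; rewrite -mono !gK].
Qed.

Lemma val_embedding (G : sgraph) (A : {set G}) :
  embedding (val : induced A -> G).
Proof. by split; [exact: val_inj |]. Qed.

Lemma embedding_comp (K H G : sgraph) (g : K -> H) (h : H -> G) :
  embedding g -> embedding h -> embedding (h \o g).
Proof.
by move=> [ig mg] [ih mh]; split; [exact: inj_comp | move=> x y /=; rewrite mh mg].
Qed.

Lemma iso_embedding (G H : sgraph) :
  graph_iso G H -> exists h : H -> G, embedding h.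
Proof.
case=> f [g fK gK] mono; exists g; split; first exact: can_inj gK.
by move=> x y; rewrite -mono !gK.
Qed.

Lemma freeP (F : sgraph -> Prop) (G : sgraph) :
  free F G <-> forall H, F H -> forall h : H -> G, ~ embedding h.
Proof.
split=> [fr H FH h eh|nofr H FH [A /iso_embedding[h eh]]]; last first.
  exact: nofr FH _ (embedding_comp eh (@val_embedding _ _)).
apply: (fr H FH); exists [set h x | x in H].
pose h' x : induced [set h x | x in H] :=
  exist (fun y => y \in _) (h x) (imset_f h (isT : x \in predT)).
have [inj mono] := eh.
apply: (@surjective_embedding_iso _ _ h').
  by split=> [x y /(congr1 val)/inj|x y] //; exact: mono.
by case=> y yA; have /imsetP[x _ E] := yA; exists x; apply: val_inj.
Qed.

Lemma free_embedding (F : sgraph -> Prop) (H G : sgraph) (h : H -> G) :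
  embedding h -> free F G -> free F H.
Proof.
move=> eh /freeP fr; apply/freeP => K FK g eg.
exact: fr FK _ (embedding_comp eg eh).
Qed.

Lemma good_embedding (H G : sgraph) (h : H -> G) (m : rel G) :
  embedding h -> good m -> good (fun x y => m (h x) (h y)).
Proof.
move=> eh [sym sub mat P3]; have [inj mono] := eh; split=> [x y|x y|x y z|x y z].
- exact: sym.
- by move/sub; rewrite mono.
- by move=> xy xz; apply: inj; exact: mat xy xz.
by rewrite -!mono -(embedding_far _ _ eh); exact: P3.
Qed.

Definition diamond_at (G : sgraph) (a b c d : G) :=
  [&& far a b, adj c d, adj a c, adj a d, adj b c & adj b d].

Lemma diamond_at_swap (G : sgraph) (a b c d : G) :
  diamond_at a b c d -> diamond_at b a c d /\ diamond_at a b d c.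
Proof.
by case/andP=> ab /and5P[cd ac ad bc bd];
   rewrite /diamond_at [far b a]far_sym [adj d c]adj_sym ab cd ac ad bc bd.
Qed.

Definition adjacent_outside (G : sgraph) (v a b c d : G) :=
  [&& v != a, v != b, v != c, v != d & [|| adj v a, adj v b, adj v c | adj v d]].

Lemma good_diamond (G : sgraph) (m : rel G) a b c d :
  good m -> diamond_at a b c d -> m a c && m b d || m a d && m b c.
Proof.
move=> [sym _ mat P3] /andP[ab /and5P[cd ac ad bc bd]].
have := P3 a c b ac; rewrite (adj_sym c) => /(_ bc ab).
have := P3 a d b ad; rewrite (adj_sym d) => /(_ bd ab).
rewrite (sym d b) (sym c b).
case mac: (m a c); case mad: (m a d); case mbc: (m b c); case mbd: (m b d) => //.
all: try by have := mat _ _ _ mac mad => E; rewrite E adj_irr in cd.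
all: try by have := mat _ _ _ mbc mbd => E; rewrite E adj_irr in cd.
Qed.

Lemma good_outside_diamond (G : sgraph) (m : rel G) (a b c d v : G) :
  good m -> diamond_at a b c d -> ~~ adjacent_outside v a b c d.
Proof.
move=> gm D; apply/negP => O.
wlog /andP[mac mbd] : c d D O / m a c && m b d.
  move=> wl; case/orP: (good_diamond gm D); first exact: wl D O.
  apply: wl; first by case: (diamond_at_swap D).
  case/and5P: O => va vb vc vd O; rewrite /adjacent_outside va vb vc vd /=.
  by move: O; rewrite [adj v c || _]orbC.
have [sym sub mat P3] := gm.
have /andP[ab /and5P[cd ac ad bc bd]] := D.
have /and5P[va vb vc vd O'] := O.
have neq x y : adj x y -> x != y by apply: contraTneq => ->; rewrite adj_irr.
have nmv x y : m x y -> v != y -> ~~ m v x.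
  by move=> mxy vy; apply: contraNN vy => mvx; apply/eqP/(mat x) => //;
     rewrite sym.
have step x y z : m x z -> v != z -> adj x y -> y != z -> v != y ->
    adj v x -> adj v y.
  move=> mxz vz xy yz vy vx; have nvx := nmv _ _ mxz vz.
  have nxy : ~~ m x y by apply: contraNN yz => mxy; rewrite (mat _ _ _ mxz mxy).
  have := P3 v x y vx xy; rewrite (negbTE nvx) (negbTE nxy) /far vy /=.
  by case: (adj v y) => // /(_ isT).
have mca : m c a by rewrite sym.
have mdb : m d b by rewrite sym.
have [dc ca da cb db] : [/\ adj d c, adj c a, adj d a, adj c b & adj d b].
  by split; rewrite adj_sym.
have [cnd anc and_ bnc bnd] : [/\ c != d, a != c, a != d, b != c & b != d].
  by split; apply: neq.
have anb : a != b by case/andP: ab.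
have s1 : adj v a -> adj v d.
  by apply: (step a d c) => //; rewrite eq_sym.
have s2 : adj v d -> adj v c by apply: (step d c b) => //; rewrite eq_sym.
have s3 : adj v c -> adj v b by apply: (step c b a) => //; rewrite eq_sym.
have s4 : adj v b -> adj v c by apply: (step b c d).
have s5 : adj v c -> adj v d by apply: (step c d a) => //; rewrite eq_sym.
have s6 : adj v d -> adj v a by apply: (step d a b).
have [va' vb'] : adj v a /\ adj v b by case/or4P: O'; auto 6.
have := P3 a v b; rewrite adj_sym va' vb' ab sym.
rewrite (negbTE (nmv _ _ mac vc)) (negbTE (nmv _ _ mbd vd)).
by move=> /(_ isT isT isT).
Qed.

Lemma good_walk (G : sgraph) (m : rel G) (v : nat -> G) k i :
  good m -> walk v k -> i <= k -> m (v i) (v i.+1) = m (v 0) (v 1) (+) odd i.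
Proof.
move=> [sym sub mat P3] [A F]; elim: i => [|i IH] ik; first by rewrite addbF.
rewrite /= addbN -IH ?(ltnW ik) //.
have := P3 _ _ _ (A i (ltnW ik)) (A i.+1 ik) (F i ik).
case m1: (m (v i) _); case m2: (m (v i.+1) _) => // _.
have /andP[/eqP[]] := F i ik; apply: (mat (v i.+1)) => //.
by rewrite sym.
Qed.

Lemma good_triangle (G : sgraph) (m : rel G) (x y z w : G) :
  good m -> adj x z -> adj y z -> adj y w -> far x w -> far z w -> ~~ m x y.
Proof.
move=> [sym sub mat P3] xz yz yw xw zw; apply/negP => mxy.
have myx : m y x by rewrite sym.
have := P3 z y w; rewrite adj_sym => /(_ yz yw zw) /orP[mzy|myw].
  have E : x = z by apply: (mat y) => //; rewrite sym.
  by rewrite E adj_irr in xz.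
by case/andP: xw => /eqP[]; exact: mat myx myw.
Qed.

Lemma good_claw (G : sgraph) (m : rel G) (x a b c : G) : good m ->
  adj x a -> adj x b -> adj x c -> far a b -> far a c -> far b c -> False.
Proof.
move=> [sym sub mat P3] xa xb xc ab ac bc.
have P y z : adj x y -> adj x z -> far y z -> m x y || m x z.
  by move=> xy xz; rewrite [m x y]sym; apply: P3; rewrite // adj_sym.
have N y z : far y z -> m x y -> m x z -> False.
  by move=> /andP[/eqP yz _] xy xz; apply/yz/(mat x).
have := (P _ _ xa xb ab, P _ _ xa xc ac, P _ _ xb xc bc).
have := (N _ _ ab, N _ _ ac, N _ _ bc).
by case: (m x a); case: (m x b); case: (m x c) => -[[n1 n2] n3] [[]] //; auto.
Qed.

Definition ord_mod n (n0 : 0 < n) i : 'I_n := Ordinal (ltn_pmod i n0).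

Lemma adj_ord_mod n (n0 : 0 < n) (r : rel nat) i j : i < n -> j < n ->
  @adj (graph_of (fun i j : 'I_n => r i j)) (ord_mod n0 i) (ord_mod n0 j) =
  (i != j) && (r i j || r j i).
Proof. by move=> i_n jn; rewrite /= -val_eqE /= !modn_small. Qed.

Lemma odd_cycle_not_good n (m : rel (cycle_graph n)) :
  odd n -> 5 <= n -> good m -> False.
Proof.
move=> on n5 gm; have n0 : 0 < n by apply: leq_trans n5.
have E i j : j < n -> (ord_mod n0 (i + j) == ord_mod n0 i) = (j == 0).
  move=> jn; rewrite -val_eqE /= -{2}[i]addn0 eqn_modDl.
  by rewrite !modn_small.
have S i : (ord_mod n0 i).+1 %% n = i.+1 %% n by rewrite /= -addn1 modnDml addn1.
have E1 i := E i 1; have E2 i := E i 2; have E3 i := E i 3.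
have w : walk (ord_mod n0 : nat -> cycle_graph n) n.
  split=> i _.
    rewrite /= [X in _ && (X || _)]eq_sym S eqxx andbT.
    by rewrite eq_sym -addn1 E1 //; lia.
  have A j : (ord_mod n0 j != ord_mod n0 j.+2) by rewrite eq_sym -addn2 E2 //; lia.
  rewrite /far A /= A !S /= negb_or.
  move: (E1 i.+1) (E3 i); rewrite addn1 addn3 -!val_eqE /= => -> ; last by lia.
  by rewrite eq_sym => ->; lia.
have := good_walk gm w (leqnn n); rewrite on.
have -> : ord_mod n0 n = ord_mod n0 0 by apply: val_inj; rewrite /= modnn mod0n.
have -> : ord_mod n0 n.+1 = ord_mod n0 1.
  by apply: val_inj; rewrite /= -addn1 modnDl.
by case: (m _ _).
Qed.

Lemma even_butterfly_not_good n (m : rel (butterfly n)) :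
  ~~ odd n -> good m -> False.
Proof.
move=> en gm; have n0 : 0 < n + 5 by rewrite addnS.
pose r i j := [|| j == i.+1, (i == 0) && (j == 2) | (i == n.+2) && (j == n.+4)].
have [b [A F]] : exists b : nat -> butterfly n,
    (forall i j, i < n + 5 -> j < n + 5 ->
       adj (b i) (b j) = (i != j) && (r i j || r j i)) /\
    (forall i j, i < n + 5 -> j < n + 5 ->
       far (b i) (b j) = (i != j) && ~~ (r i j || r j i)).
  exists (ord_mod n0); split=> i j i_n jn; first exact: (adj_ord_mod n0 r).
  rewrite /far (adj_ord_mod n0 r) // -val_eqE /= !modn_small //.
  by case: (i != j).
pose v i := b (if i == 0 then 0 else i.+1).
have v0 : v 0 = b 0 by [].
have vS i : v i.+1 = b i.+2 by [].
have w : walk v n.+1.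
  by split=> -[|i] ik; rewrite ?v0 !vS ?A ?F /r; lia.
have := good_walk gm w (leqnn _); rewrite /= en addbT.
have -> : m (v 0) (v 1) = false.
  by apply/negbTE/(good_triangle (z := b 1) (w := b 3) gm);
     rewrite ?v0 ?vS ?A ?F /r; lia.
have -> : m (v n.+1) (v n.+2) = false.
  have [sym _ _ _] := gm; rewrite sym !vS.
  by apply/negbTE/(good_triangle (z := b n.+4) (w := b n.+1) gm);
     rewrite ?A ?F /r; lia.
by [].
Qed.

(** * Forbidden graphs *)

Lemma delete01E n (x y : 'I_n.+2) :
  @adj (@delete_edge (complete_graph n.+2) (inord 0) (inord 1)) x y =
  (x != y) && ((1 < x) || (1 < y)).
Proof.
have D (u v : 'I_n.+2) : u != v ->
    (([set u; v] : {set 'I_n.+2}) != [set inord 0; inord 1]) = (1 < u) || (1 < v).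
  have E0 : val (inord 0 : 'I_n.+2) = 0 by rewrite /= inordK.
  have E1 : val (inord 1 : 'I_n.+2) = 1 by rewrite /= inordK.
  rewrite -val_eqE => uv; apply/idP/idP; last first.
    by apply: contraTN => /eqP/set2_inj[][-> ->]; rewrite E0 E1.
  apply: contraR; rewrite negb_or -!leqNgt => /andP[u1 v1]; apply/eqP.
  have [u0|u0] := posnP u.
    by congr [set _; _]; apply: val_inj; rewrite ?E0 ?E1 //=;
       move: uv; rewrite /= u0; lia.
  by rewrite setUC; congr [set _; _]; apply: val_inj; rewrite ?E0 ?E1 /=;
     move: uv => /=; lia.
rewrite /=; case: (eqVneq x y) => //= xy; rewrite !D //; last by rewrite eq_sym.
by rewrite /= [(1 < y) || _]orbC orbb.
Qed.

Lemma diamondE (x y : 'I_4) :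
  @adj diamond x y = (x != y) && ((1 < x) || (1 < y)).
Proof. exact: delete01E. Qed.

Lemma dvE (x : 'I_4) i : i < 4 -> (x == dv i :> diamond) = (x == i :> nat).
Proof. by move=> i4; rewrite -[LHS]val_eqE /= inordK. Qed.

Lemma add_vertexE (G : sgraph) (N : {set G}) (x y : G) :
  @adj (add_vertex N) (Some x) (Some y) = adj x y.
Proof.
rewrite /= (inj_eq Some_inj) [adj y x]adj_sym orbb.
by case: eqVneq => // ->; rewrite adj_irr.
Qed.

Lemma embedding_ord n (r : rel nat) (G : sgraph) (u : nat -> G) :
  (forall i j, i < j -> j < n ->
     if r i j || r j i then adj (u i) (u j) else far (u i) (u j)) ->
  embedding (fun i : graph_of (fun i j : 'I_n => r i j) => u (i : 'I_n)).
Proof.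
move=> E; apply: embeddingI => x y xy.
rewrite /= xy /=; move: xy; rewrite -val_eqE /=.
case: (ltngtP x y) => // xy _; first exact: E.
by have := E _ _ xy (ltn_ord x); rewrite orbC adj_sym far_sym.
Qed.

Lemma embedding_join (G1 G2 G : sgraph) (h1 : G1 -> G) (h2 : G2 -> G) :
  embedding h1 -> embedding h2 -> (forall x y, adj (h1 x) (h2 y)) ->
  embedding (fun x : join G1 G2 =>
    match x : G1 + G2 with inl y => h1 y | inr y => h2 y end).
Proof.
move=> e1 e2 a12; apply: embeddingI => -[x|x] [y|y] /=.
- rewrite (inj_eq inl_inj) => xy; rewrite xy [adj y x]adj_sym orbb /=.
  by rewrite e1.2 (embedding_far _ _ e1) /far xy; case: (adj x y).
- by [].
- by rewrite adj_sym.
rewrite (inj_eq inr_inj) => xy; rewrite xy [adj y x]adj_sym orbb /=.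
by rewrite e2.2 (embedding_far _ _ e2) /far xy; case: (adj x y).
Qed.

Lemma embedding_complete1 (G : sgraph) (x : G) :
  embedding (fun _ : complete_graph 1 => x).
Proof. by apply: embeddingI => i j; rewrite (ord1 i) (ord1 j). Qed.

Lemma embedding_add_vertex (H G : sgraph) (N : {set H}) (h : H -> G) (v : G) :
  embedding h -> (forall x, if x \in N then adj v (h x) else far v (h x)) ->
  embedding (fun x : add_vertex N => if x is Some y then h y else v).
Proof.
move=> eh hN; apply: embeddingI => -[x|] [y|] //.
- rewrite add_vertexE (inj_eq Some_inj) => xy.
  by rewrite eh.2 (embedding_far _ _ eh) /far xy; case: (adj x y).
- by have := hN x; rewrite /= adj_sym far_sym.
by have := hN y; rewrite /= orbF.
Qed.

Section SmallGraphs.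
Variable G : sgraph.
Implicit Types (a b c d v : G).

Lemma embedding_diamond a b c d : diamond_at a b c d ->
  embedding (fun x : diamond => nth a [:: a; b; c; d] (x : 'I_4)).
Proof.
case/andP=> ab /and5P[cd ac ad bc bd]; apply: embeddingI => x y.
rewrite diamondE -val_eqE => xy; rewrite xy; move: xy.
by case: x y => [[|[|[|[|]]]]] //= ? [[|[|[|[|]]]]] //= ?;
   rewrite // 1?far_sym // adj_sym.
Qed.

Lemma diamond_iso a b c d : diamond_at a b c d ->
  (forall x, x \in [:: a; b; c; d]) -> graph_iso G diamond.
Proof.
move=> /embedding_diamond eh all4; apply: (surjective_embedding_iso eh) => x.
have x4 : index x [:: a; b; c; d] < 4 by rewrite index_mem.
by exists (Ordinal x4); rewrite /= nth_index.
Qed.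

Hypothesis fr : free forbidden G.

Let nofree (H : sgraph) (h : H -> G) : forbidden H -> ~ embedding h.
Proof. by move/freeP: fr => fr' /fr'; apply. Qed.

Lemma free_claw v a b c : adj v a -> adj v b -> adj v c ->
  far a b -> far a c -> far b c -> False.
Proof.
move=> va vb vc ab ac bc; apply: (nofree forbidden_claw).
apply: (embedding_join (embedding_complete1 v)
   (@embedding_ord 3 (fun _ _ => false) G (nth a [:: a; b; c]) _)).
  by move=> i [|[|[|]]] //; case: i => [|[|[|]]].
by move=> _ [[|[|[|]]] ?].
Qed.

Lemma free_odd_hole n (u : nat -> G) : odd n -> 5 <= n ->
  (forall i j, i < j -> j < n ->
     if (j == i.+1) || (i == 0) && (j == n.-1) then adj (u i) (u j)
     else far (u i) (u j)) -> False.
Proof.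
move=> on n5 E; apply: (nofree (forbidden_odd_hole on n5)).
apply: (@embedding_ord n (fun i j => j == i.+1 %% n) G u) => i j ij jn.
have := E i j ij jn; congr (is_true (if _ then _ else _)).
rewrite modn_small ?(leq_ltn_trans ij) //; congr (_ || _).
have [jn'|jn'] := eqVneq j n.-1; last by rewrite andbF modn_small; lia.
by rewrite (_ : j.+1 = n) ?modnn ?andbT //; lia.
Qed.

Lemma free_even_butterfly n (u : nat -> G) : ~~ odd n ->
  (forall i j, i < j -> j < n + 5 ->
     if [|| j == i.+1, (i == 0) && (j == 2) | (i == n.+2) && (j == n.+4)]
     then adj (u i) (u j) else far (u i) (u j)) -> False.
Proof.
move=> en E.
have := forbidden_even_butterfly n./2; rewrite even_halfK // => /nofree; apply.
apply: (@embedding_ord (n + 5) (fun i j =>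
  [|| j == i.+1, (i == 0) && (j == 2) | (i == n.+2) && (j == n.+4)]) G u).
move=> i j ij jn; have := E i j ij jn; congr (is_true (if _ then _ else _)).
by lia.
Qed.

Lemma free_no_wheel v a b c d : adj a b -> adj b c -> adj c d -> adj d a ->
  far a c -> far b d -> adj v a -> adj v b -> adj v c -> adj v d -> False.
Proof.
move=> ab bc cd da ac bd va vb vc vd; apply: (nofree forbidden_four_wheel).
apply: (embedding_join (@embedding_ord 4 (fun i j => j == i.+1 %% 4) G
   (nth a [:: a; b; c; d]) _) (embedding_complete1 v)).
  by move=> i [|[|[|[|]]]] //; case: i => [|[|[|[|]]]] //=; rewrite adj_sym.
by move=> [[|[|[|[|]]]] ?] // _ /=; rewrite adj_sym.
Qed.

Lemma free_no_gem v a b c d : adj a b -> adj b c -> adj c d ->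
  far a c -> far a d -> far b d -> adj v a -> adj v b -> adj v c -> adj v d ->
  False.
Proof.
move=> ab bc cd ac ad bd va vb vc vd; apply: (nofree forbidden_gem).
apply: (embedding_join (@embedding_ord 4 (fun i j => j == i.+1) G
   (nth a [:: a; b; c; d]) _) (embedding_complete1 v)).
  by move=> i [|[|[|[|]]]] //; case: i => [|[|[|[|]]]].
by move=> [[|[|[|[|]]]] ?] // _ /=; rewrite adj_sym.
Qed.

Section OutsideDiamond.
Variables (a b c d v : G).
Hypothesis D : diamond_at a b c d.

Lemma free_no_kite : adj v a -> far v b -> far v c -> far v d -> False.
Proof.
move=> va vb vc vd; apply: (nofree forbidden_kite).
apply: (embedding_add_vertex (embedding_diamond D) (v := v)) => x.
by rewrite inE dvE //; case: x => [[|[|[|[|]]]]] /=.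
Qed.

Lemma free_no_X1 : adj v a -> adj v b -> far v c -> far v d -> False.
Proof.
move=> va vb vc vd; apply: (nofree forbidden_X1).
apply: (embedding_add_vertex (embedding_diamond D) (v := v)) => x.
by rewrite !inE !dvE //; case: x => [[|[|[|[|]]]]] /=.
Qed.

Lemma free_no_X2 : adj v a -> far v b -> adj v c -> adj v d -> False.
Proof.
move=> va vb vc vd; apply: (nofree forbidden_X2).
apply: (embedding_add_vertex (embedding_diamond D) (v := v)) => x.
by rewrite !inE !dvE //; case: x => [[|[|[|[|]]]]] /=.
Qed.

Lemma free_no_K5_minus_e : adj v a -> adj v b -> adj v c -> adj v d -> False.
Proof.
have /andP[ab /and5P[cd ac ad bc bd]] := D.
move=> va vb vc vd; apply: (nofree (h := fun x : K5_minus_e =>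
  nth a [:: a; b; c; d; v] (x : 'I_5)) forbidden_K5_minus_e).
apply: embeddingI => x y; rewrite delete01E -val_eqE => xy; rewrite xy; move: xy.
by case: x y => [[|[|[|[|[|]]]]]] //= ? [[|[|[|[|[|]]]]]] //= ?;
   rewrite // 1?far_sym // adj_sym.
Qed.

Lemma free_no_wheel_at : adj v a -> adj v b -> adj v c -> far v d -> False.
Proof.
have /andP[ab /and5P[cd ac ad bc bd]] := D.
by move=> va vb vc vd; apply: (@free_no_wheel c v a d b); rewrite // adj_sym.
Qed.

Lemma free_no_gem_at : adj v a -> far v b -> adj v c -> far v d -> False.
Proof.
have /andP[ab /and5P[cd ac ad bc bd]] := D.
by move=> va vb vc vd; apply: (@free_no_gem c v a d b); rewrite // adj_sym.
Qed.

Lemma free_no_claw_at : far v a -> far v b -> adj v c -> False.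
Proof.
have /andP[ab /and5P[cd ac ad bc bd]] := D.
by move=> va vb vc; apply: (@free_claw c v a b) => //; rewrite adj_sym.
Qed.

End OutsideDiamond.

Lemma free_outside_diamond a b c d v :
  diamond_at a b c d -> ~~ adjacent_outside v a b c d.
Proof.
move=> D; have [Dab Dcd] := diamond_at_swap D; have [_ Dabcd] := diamond_at_swap Dab.
apply/negP => /and5P[va vb vc vd].
have F x : v != x -> adj v x = false -> far v x by rewrite /far => -> ->.
move: (F _ va) (F _ vb) (F _ vc) (F _ vd).
have := (@free_no_kite _ _ _ _ v D, @free_no_kite _ _ _ _ v Dab).
have := (@free_no_X1 _ _ _ _ v D, @free_no_K5_minus_e _ _ _ _ v D).
have := (@free_no_X2 _ _ _ _ v D, @free_no_X2 _ _ _ _ v Dab).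
have := (@free_no_wheel_at _ _ _ _ v D, @free_no_wheel_at _ _ _ _ v Dcd).
have := (@free_no_claw_at _ _ _ _ v D, @free_no_claw_at _ _ _ _ v Dcd).
have := (@free_no_gem_at _ _ _ _ v D, @free_no_gem_at _ _ _ _ v Dab).
have := (@free_no_gem_at _ _ _ _ v Dcd, @free_no_gem_at _ _ _ _ v Dabcd).
case: (adj v a); case: (adj v b); case: (adj v c); case: (adj v d) => //=; intuition.
Qed.

Lemma free_no_diamond_good :
  (forall a b c d, ~~ diamond_at a b c d) -> exists m : rel G, good m.
Proof.
move=> noD; apply: good_of_claw_diamond_free.
- exact: free_claw.
- exact: free_odd_hole.
- move=> a b c d ab cd ac ad bc bd; apply: (negP (noD a b c d)).
  by apply/andP; split=> //; apply/and5P.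
exact: free_even_butterfly.
Qed.

End SmallGraphs.

Lemma diamond_at_diamond : diamond_at (dv 0) (dv 1) (dv 2) (dv 3).
Proof. by rewrite /diamond_at /far !diamondE -!val_eqE /= !inordK. Qed.

Lemma good_diamond_graph : exists m : rel diamond, good m.
Proof.
exists (fun x y : 'I_4 => (y == x.+2 :> nat) || (x == y.+2 :> nat)).
split=> [x y|x y|x y z|x y z].
- by rewrite orbC.
- by rewrite diamondE -val_eqE; case: x y => [[|[|[|[|]]]]] // ? [[|[|[|[|]]]]].
- case: x y z => [[|[|[|[|]]]]] // ? [[|[|[|[|]]]]] // ? [[|[|[|[|]]]]] // ? *;
    exact: val_inj.
rewrite /far !diamondE -!val_eqE.
by case: x y z => [[|[|[|[|]]]]] // ? [[|[|[|[|]]]]] // ? [[|[|[|[|]]]]].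
Qed.

Lemma add_vertex_not_good (N : {set diamond}) (m : rel (add_vertex N)) :
  N != set0 -> ~ good m.
Proof.
case/set0Pn=> x xN gm.
have D : @diamond_at (add_vertex N)
    (Some (dv 0)) (Some (dv 1)) (Some (dv 2)) (Some (dv 3)).
  have := diamond_at_diamond; rewrite /diamond_at /far !add_vertexE.
  by rewrite !(inj_eq Some_inj).
case/negP: (good_outside_diamond (None : add_vertex N) gm D); apply/and5P; split=> //.
move: xN; rewrite /= !orbF.
have : [|| x == dv 0, x == dv 1, x == dv 2 | x == dv 3].
  by rewrite !dvE //; case: x => [[|[|[|[|]]]]].
by case/or4P => /eqP-> ->; rewrite ?orbT.
Qed.

Lemma good_free (G : sgraph) (m : rel G) : good m -> free forbidden G.
Proof.
move=> gm; apply/freeP => H FH h /good_embedding/(_ gm).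
move: (fun x y => _) => m';
case: FH m' {h m gm} => [m|m|m|m|m|m|m|n on n5 m|n m] gm.
- pose c : claw := inl (ord0 : 'I_1).
  pose b i : claw := inr (inord i : 'I_3).
  have B i j : i < 3 -> j < 3 -> far (b i) (b j) = (i != j).
    move=> i3 j3; rewrite /far /= !(inj_eq inr_inj) -val_eqE /= !inordK //.
    by case: eqVneq => //= _; rewrite andbF.
  by apply: (good_claw (x := c) (a := b 0) (b := b 1) (c := b 2) gm);
     rewrite ?B.
- pose r i (i4 : i < 4) : four_wheel := inl (Ordinal i4).
  by case/negP: (@good_outside_diamond _ _ (r 0 isT) (r 2 isT) (r 1 isT) (inr ord0)
    (r 3 isT) gm isT).
- pose p i (i4 : i < 4) : gem := inl (Ordinal i4).
  by case/negP: (@good_outside_diamond _ _ (p 0 isT) (p 2 isT) (p 1 isT) (inr ord0)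
    (p 3 isT) gm isT).
- by apply: add_vertex_not_good gm; apply/set0Pn; exists (dv 0); rewrite !inE eqxx.
- by apply: add_vertex_not_good gm; apply/set0Pn; exists (dv 0); rewrite !inE eqxx.
- by apply: add_vertex_not_good gm; apply/set0Pn; exists (dv 2); rewrite !inE eqxx.
- pose k i : K5_minus_e := (inord i : 'I_5).
  have K i j : i < 5 -> j < 5 -> adj (k i) (k j) = (i != j) && ((1 < i) || (1 < j)).
    by move=> i5 j5; rewrite delete01E -val_eqE /= !inordK.
  have K' i j : i < 5 -> j < 5 -> (k i == k j) = (i == j).
    by move=> i5 j5; rewrite -[LHS]val_eqE /= !inordK.
  have D : diamond_at (k 0) (k 1) (k 2) (k 3) by rewrite /diamond_at /far !K ?K'.
  by case/negP: (good_outside_diamond (k 4) gm D); rewrite /adjacent_outside !K ?K'.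
- exact: odd_cycle_not_good gm.
by apply: even_butterfly_not_good gm; rewrite odd_double.
Qed.

(** * Edge colourings and components *)

Lemma mem_edges (G : sgraph) (x y : G) : ([set x; y] \in edges G) = adj x y.
Proof.
apply/imsetP/idP => [[[a b] /= ab] /set2_inj[][-> ->] //|xy].
  by rewrite adj_sym.
by exists (x, y).
Qed.

Lemma edge_ends (G : sgraph) (e : edge G) :
  exists x y, adj x y /\ val e = [set x; y].
Proof. by have /imsetP[[x y] xy E] := valP e; exists x, y. Qed.

Definition edge_of (G : sgraph) (x y : G) (xy : adj x y) : edge G :=
  exist (fun e => e \in edges G) [set x; y] (etrans (mem_edges x y) xy).

Definition pair_colour (G : cgraph) (x y : G) : colour :=
  if insub [set x; y] is Some e then edge_colour (e : edge G) else Red.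

Lemma pair_colourE (G : cgraph) (e : edge G) (x y : G) :
  val e = [set x; y] -> pair_colour x y = edge_colour e.
Proof. by move=> E; rewrite /pair_colour -E valK. Qed.

Lemma pair_colourC (G : cgraph) (x y : G) : pair_colour x y = pair_colour y x.
Proof. by rewrite /pair_colour setUC. Qed.

Definition cembedding (H G : cgraph) (h : H -> G) :=
  embedding h /\ forall x y, adj x y -> pair_colour (h x) (h y) = pair_colour x y.

Lemma cfreeP (F : cgraph -> Prop) (G : cgraph) :
  cfree F G <-> forall H, F H -> forall h : H -> G, ~ cembedding h.
Proof.
split=> [fr H FH h [eh ch]|nofr H FH [A [f [[g fK gK] mono col]]]]; last first.
  have mg : {mono g : x y / adj x y} by move=> x y; rewrite -mono !gK.
  apply: (nofr H FH (val \o g)); split.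
    by apply: embedding_comp (@val_embedding _ _); split; first exact: can_inj gK.
  move=> x y xy; have gxy : @adj (cinduced A) (g x) (g y) by rewrite mg.
  rewrite (pair_colourE (e := edge_of xy)) //.
  rewrite (@col (edge_of gxy) (edge_of xy)) /=; last first.
    by rewrite imsetU1 imset_set1 !gK.
  by rewrite (pair_colourE (e := induced_edge (edge_of gxy))) //=
     imsetU1 imset_set1.
apply: (fr H FH); exists [set h x | x in H].
have [inj mono] := eh.
pose h' x : induced [set h x | x in H] :=
  exist (fun y => y \in [set h x | x in H]) (h x) (imset_f h (isT : x \in predT)).
have [g h'K gK] : bijective h'.
  apply: inj_surj_bij => [x y /(congr1 val)/inj //|[y yA]].
  by have /imsetP[x _ E] := yA; exists x; apply: val_inj.
have hg x : h (g x) = val x by rewrite -[in RHS](gK x).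
have mg : {mono g : x y / adj x y} by move=> x y; rewrite -mono !hg.
exists g; split=> // [|e e']; first by exists h'.
have [x [y [xy E]]] := edge_ends e.
rewrite E imsetU1 imset_set1 => E'.
rewrite -(pair_colourE E') -ch ?mg // !hg /=.
by apply: pair_colourE; rewrite /= E imsetU1 imset_set1.
Qed.

Definition other (k : colour) := if k is Red then Blue else Red.
Definition is_colour (k l : colour) : bool :=
  match k, l with Red, Red | Blue, Blue => true | _, _ => false end.

Lemma is_colourP k l : if is_colour k l then l = k else l = other k.
Proof. by case: k; case: l. Qed.

Lemma mono_P3_colour k (x y : mono_P3 k) : adj x y -> pair_colour x y = k.
Proof. by move=> xy; rewrite (pair_colourE (e := edge_of xy)). Qed.

Lemma mono_K3_colour k (x y : mono_K3 k) : adj x y -> pair_colour x y = k.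
Proof. by move=> xy; rewrite (pair_colourE (e := edge_of xy)). Qed.

Lemma mixed_K3_colour c d (x y : 'I_3) : x != y ->
  @pair_colour (mixed_K3 c d) x y = if (x < 2) && (y < 2) then d else c.
Proof.
move=> nxy; have xy : @adj (mixed_K3 c d) x y by rewrite /= nxy.
rewrite (pair_colourE (e := edge_of xy)) //=; congr (if _ then _ else _).
have E0 : val (inord 0 : 'I_3) = 0 by rewrite /= inordK.
have E1 : val (inord 1 : 'I_3) = 1 by rewrite /= inordK.
apply/eqP/andP => [/set2_inj[][-> ->]|[x2 y2]]; first by rewrite E0 E1.
  by rewrite E0 E1.
move: nxy; rewrite -val_eqE /= => nxy.
have [x0|x0] := posnP x.
  by congr [set _; _]; apply: val_inj; rewrite ?E0 ?E1 //=; lia.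
by rewrite setUC; congr [set _; _]; apply: val_inj; rewrite ?E0 ?E1 /=; lia.
Qed.

Definition pattern k (P : cgraph) :=
  [\/ P = bP3, P = rP3, P = mono_K3 k | P = mixed_K3 k (other k)].

Lemma pattern_P3 k l : pattern k (mono_P3 l).
Proof. by case: l; [constructor 2 | constructor 1]. Qed.

Section FreeColouring.
Variables (G : cgraph) (k : colour).
Hypothesis fr : cfree (pattern k) G.
Implicit Types (x y z : G).

Lemma cfree_P3 x y z : adj x y -> adj y z -> far x z ->
  pair_colour x y = pair_colour y z -> False.
Proof.
move=> xy yz xz E; move/cfreeP: fr => nofr.
apply: (nofr _ (pattern_P3 k (pair_colour x y))
  (fun i : 'I_3 => nth x [:: x; y; z] i)); split.
  apply: (@embedding_ord 3 (fun i j => j == i.+1) G).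
  by move=> i [|[|[|]]] //; case: i => [|[|[|]]].
move=> i j ij; rewrite mono_P3_colour //; move: ij.
by case: i j => [[|[|[|]]]] // ? [[|[|[|]]]] // ? _ /=; rewrite // pair_colourC.
Qed.

Lemma cfree_K3 x y z : adj x y -> adj x z -> adj y z ->
  pair_colour x y = k -> pair_colour x z = k -> False.
Proof.
move=> xy xz yz kxy kxz; move/cfreeP: fr => nofr.
have emb : embedding (fun i : complete_graph 3 => nth x [:: y; z; x] (i : 'I_3)).
  apply: (@embedding_ord 3 (fun _ _ => true) G).
  by move=> i [|[|[|]]] //; case: i => [|[|[|]]] //=; rewrite adj_sym.
have := is_colourP k (pair_colour y z); case: ifP => _ kyz.
  apply: (nofr (mono_K3 k) _ (fun i : 'I_3 => nth x [:: y; z; x] i)).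
    by constructor 3.
  split=> // i j ij; rewrite mono_K3_colour //; move: ij.
  by case: i j => [[|[|[|]]]] // ? [[|[|[|]]]] // ? _ /=; rewrite // pair_colourC.
apply: (nofr (mixed_K3 k (other k)) _ (fun i : 'I_3 => nth x [:: y; z; x] i)).
  by constructor 4.
split=> // i j /= /andP[ij _]; rewrite mixed_K3_colour //; move: ij.
by case: i j => [[|[|[|]]]] // ? [[|[|[|]]]] // ? _ /=; rewrite // pair_colourC.
Qed.

Lemma cfree_good : good (fun x y => adj x y && is_colour k (pair_colour x y)).
Proof.
split=> [x y|x y /andP[] //|x y z /andP[xy kxy] /andP[xz kxz]|x y z xy yz xz].
- by rewrite adj_sym pair_colourC.
- move: (is_colourP k (pair_colour x y)) (is_colourP k (pair_colour x z)).
  rewrite kxy kxz => {}kxy {}kxz; apply/eqP/contraT => nyz.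
  have [yz|nadj] := boolP (adj y z); first by case: (cfree_K3 xy xz yz).
  case: (@cfree_P3 y x z); rewrite // 1?adj_sym //; first by rewrite /far nyz.
  by rewrite pair_colourC kxy.
rewrite xy yz /=; apply: contraT; rewrite negb_or => /andP[/negbTE nxy /negbTE nyz].
case: (cfree_P3 xy yz xz).
move: (is_colourP k (pair_colour x y)) (is_colourP k (pair_colour y z)).
by rewrite nxy nyz => -> ->.
Qed.

End FreeColouring.

Lemma has_free_colouring_good k (G : sgraph) :
  has_free_colouring (pattern k) G <-> exists m : rel G, good m.
Proof.
split=> [[c /cfree_good gm]|[m gm]]; first by eexists; exact: gm.
have [sym sub mat P3] := gm.
pose c (e : edge G) := if [exists x, exists y, (val e == [set x; y]) && m x y]
  then k else other k.
have cE x y : adj x y -> @pair_colour (CGraph c) x y = if m x y then k else other k.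
  move=> xy; rewrite (pair_colourE (G := CGraph c) (e := edge_of xy)) //=.
  congr (if _ then _ else _).
  apply/existsP/idP => [[a /existsP[b /andP[/eqP/set2_inj E mab]]]|mxy].
    by case: E mab => [][-> ->]; rewrite 1?sym.
  by exists x; apply/existsP; exists y; rewrite eqxx.
have colour_m x y : adj x y -> @pair_colour (CGraph c) x y = k -> m x y.
  by move=> /cE ->; case: ifP => // _; case: (k).
exists c; apply/cfreeP => H FH h [eh ch].
have Hm x y : adj x y -> pair_colour x y = k -> m (h x) (h y).
  by move=> xy kxy; apply: colour_m; [rewrite eh.2 | rewrite ch].
have matched (x y z : H) :
    adj x y -> adj x z -> y <> z -> pair_colour x y = k ->
    pair_colour x z = k -> False.
  by move=> xy xz yz /(Hm _ _ xy) mxy /(Hm _ _ xz) /(mat _ _ _ mxy)/eh.1.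
pose o i (i3 : i < 3) : 'I_3 := Ordinal i3.
have o12 : o 1 isT <> o 2 isT by move/(congr1 val).
have o01 : o 0 isT <> o 1 isT by move/(congr1 val).
have noP3 l : H <> mono_P3 l.
  move=> E; move: h eh ch Hm matched; rewrite E => h eh ch _ matched {FH E H}.
  have a01 : @adj (mono_P3 l) (o 0 isT) (o 1 isT) by [].
  have a12 : @adj (mono_P3 l) (o 1 isT) (o 2 isT) by [].
  have f02 : @far (mono_P3 l) (o 0 isT) (o 2 isT) by [].
  have [lk|lk] : l = k \/ l = other k.
  - by have := is_colourP k l; case: ifP; [left | right].
  - apply: (matched (o 1 isT) (o 0 isT) (o 2 isT)) => //.
    + by rewrite pair_colourC mono_P3_colour.
    + by rewrite mono_P3_colour.
  have := P3 (h (o 0 isT)) (h (o 1 isT)) (h (o 2 isT)).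
  rewrite !eh.2 (embedding_far _ _ eh) => /(_ a01 a12 f02).
  have nm x y : adj x y -> m (h x) (h y) = false.
    move=> xy; have := ch x y xy; rewrite mono_P3_colour // cE ?eh.2 // lk.
    by case: ifP => //; case: (k).
  by rewrite !nm.
case: FH => [/(noP3 Blue)//|/(noP3 Red)//|E|E].
- move: h eh ch Hm matched; rewrite E => h _ _ _ matched.
  have a i j : i != j -> @adj (mono_K3 k) i j by move=> /= ->.
  have [a01 a02] := (a (o 0 isT) (o 1 isT) isT, a (o 0 isT) (o 2 isT) isT).
  exact: (matched _ _ _ a01 a02 o12 (mono_K3_colour a01) (mono_K3_colour a02)).
move: h eh ch Hm matched; rewrite E => h _ _ _ matched.
have a i j : i != j -> @adj (mixed_K3 k (other k)) i j by move=> /= ->.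
have [a20 a21] := (a (o 2 isT) (o 0 isT) isT, a (o 2 isT) (o 1 isT) isT).
by apply: (matched _ _ _ a20 a21 o01); rewrite mixed_K3_colour.
Qed.

Definition connected (G : sgraph) := forall A : pred G,
  (forall x y, adj x y -> A x -> A y) -> forall x y, A x -> A y.

Lemma connect_closed (T : finType) (e : rel T) (A : pred T) :
  (forall x y, e x y -> A x -> A y) -> forall x y, connect e x y -> A x -> A y.
Proof.
move=> cl x y /connectP[p pth ->]; elim: p x pth => //= z p IH x /andP[xz pth].
by move=> /(cl _ _ xz); apply: IH.
Qed.

Section Components.
Variable G : sgraph.

Definition component (x : G) : {set G} := [set y | connect (@adj G) x y].

Lemma connect_adj_sym : connect_sym (@adj G).
Proof. exact/sym_connect_sym/adj_sym. Qed.

Lemma component_in (x : G) : component x \in components G.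
Proof.
apply/imsetP; exists x => //; apply/setP => y.
by rewrite !inE.
Qed.

Lemma componentE (C : {set G}) x : C \in components G -> x \in C ->
  component x = C.
Proof.
case/imsetP=> y _ ->; rewrite !inE /= => yx; apply/setP => z.
by rewrite !inE (same_connect connect_adj_sym yx).
Qed.

Lemma mem_component (x : G) : x \in component x.
Proof. by rewrite inE connect0. Qed.

Lemma adj_component (x y : G) : adj x y -> y \in component x.
Proof. by move=> xy; rewrite inE connect1. Qed.

Lemma connected_component (C : {set G}) :
  C \in components G -> connected (induced C).
Proof.
move=> CC A cl x y Ax.
pose B (u : G) := [exists z : induced C, (val z == u) && A z].
have clB u v : adj u v -> B u -> B v.
  move=> uv /existsP[z /andP[/eqP zu Az]].
  have vC : v \in C by rewrite -(componentE CC (valP z)) zu adj_component.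
  apply/existsP; exists (Sub v vC); rewrite eqxx /=.
  by apply: cl Az; rewrite /= zu.
have xy : connect (@adj G) (val x) (val y).
  have : val y \in component (val x) by rewrite (componentE CC (valP x)) (valP y).
  by rewrite inE.
have /existsP[z /andP[/eqP/val_inj-> //]] : B (val y).
by apply: (connect_closed clB xy); apply/existsP; exists x; rewrite eqxx.
Qed.

Lemma good_components :
  (forall C, C \in components G -> exists m : rel (induced C), good m) ->
  exists m : rel G, good m.
Proof.
move=> gC; have /fin_all_exists[f fP] : forall C : {set G},
    exists m : rel (induced C), C \in components G -> good m.
  move=> C; have [/gC[m gm]|nC] := boolP (C \in components G); first by exists m.
  by exists (fun _ _ => false).
pose mm C (x y : G) := if insub x : option (induced C) is Some x' then
  if insub y is Some y' then f C x' y' else false else false.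
pose m x y := mm (component x) x y.
have mE C (x y : induced C) : C \in components G -> m (val x) (val y) = f C x y.
  by move=> CC; rewrite /m (componentE CC (valP x)) /mm !valK.
have mC x y : m x y -> y \in component x.
  rewrite /m /mm; case: (insub x) => // x'.
  by case: (insubP (induced (component x)) y) => // y' yx _ _.
have lift (x y : G) : y \in component x -> exists2 y' : induced (component x),
    val y' = y & component y = component x.
  by move=> yx; exists (Sub y yx) => //; apply: componentE yx; apply: component_in.
have good_at x : good (f (component x)) by apply/fP/component_in.
have symm x y : m x y -> m y x.
  move=> mxy; have [x' Ex _] := lift x x (mem_component x).
  have [y' Ey _] := lift x y (mC _ _ mxy); have [sym _ _ _] := good_at x.
  by move: mxy; rewrite -Ex -Ey !mE ?component_in // sym.
exists m; split=> [x y|x y mxy|x y z mxy mxz|x y z xy yz xz].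
- by apply/idP/idP; apply: symm.
- have [x' Ex _] := lift x x (mem_component x).
  have [y' Ey _] := lift x y (mC _ _ mxy); have [_ sub _ _] := good_at x.
  by move: mxy; rewrite -Ex -Ey mE ?component_in // => /sub.
- have [x' Ex _] := lift x x (mem_component x).
  have [y' Ey _] := lift x y (mC _ _ mxy).
  have [z' Ez _] := lift x z (mC _ _ mxz); have [_ _ mat _] := good_at x.
  move: mxy mxz; rewrite -Ex -Ey -Ez !mE ?component_in // => mxy mxz.
  by rewrite (mat _ _ _ mxy mxz).
have [x' Ex _] := lift x x (mem_component x).
have [y' Ey Eyx] := lift x y (adj_component xy).
have [z' Ez _] : exists2 z' : induced (component x),
    val z' = z & component z = component x.
  by apply: lift; rewrite -Eyx adj_component.
have [_ _ _ P3] := good_at x.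
move: xy yz xz; rewrite -Ex -Ey -Ez !mE ?component_in // => xy yz xz.
exact: (P3 x' y' z').
Qed.

End Components.

(** * Line graphs of incidence graphs *)

Lemma card_setU1_le2 (T : finType) (m : rel T) (x : T) :
  (forall y z, m x y -> m x z -> y = z) -> #|[set y | (y == x) || m x y]| <= 2.
Proof.
move=> mat; case: (pickP (m x)) => [y xy|no].
  apply: leq_trans (_ : #|[set x; y]| <= 2); last by rewrite cards2; case: eqP.
  apply/subset_leq_card/subsetP => z; rewrite !inE => /orP[->//|xz].
  by rewrite (mat z y) ?eqxx ?orbT.
apply: leq_trans (_ : #|[set x]| <= 2); last by rewrite cards1.
by apply/subset_leq_card/subsetP => z; rewrite !inE no orbF.
Qed.

Section RedTransitive.
Variables (G : sgraph) (m : rel G).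
Hypothesis gm : good m.
Let red x y := adj x y && ~~ m x y.
Hypothesis red_trans : forall x y z, red x y -> red y z -> x != z -> red x z.

Let sym : symmetric m. Proof. by case: gm. Qed.
Let sub x y : m x y -> adj x y. Proof. by case: gm => _ + _ _; apply. Qed.
Let mat x y z : m x y -> m x z -> y = z.
Proof. by case: gm => _ _ + _; apply. Qed.
Let red_sym : symmetric red.
Proof. by move=> x y; rewrite /red adj_sym sym. Qed.

Let blue_class (x : G) := [set y | (y == x) || m x y].
Let red_class (x : G) := [set y | (y == x) || red x y].

Let blue_classP x y : reflect (x = y \/ m x y) (blue_class x == blue_class y).
Proof.
apply: (iffP eqP) => [/setP/(_ y)|[->//|xy]].
  by rewrite !inE eqxx /= => /orP[/eqP->|]; [left|right].
apply/setP => z; rewrite !inE; apply/orP/orP => -[/eqP->|].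
- by right; rewrite sym.
- by move/(mat xy) => ->; left.
- by right.
by rewrite sym in xy => /(mat xy) => ->; left.
Qed.

Let red_classP x y : reflect (x = y \/ red x y) (red_class x == red_class y).
Proof.
apply: (iffP eqP) => [/setP/(_ y)|[->//|xy]].
  by rewrite !inE eqxx /= => /orP[/eqP->|]; [left|right].
have yx : red y x by rewrite red_sym.
apply/setP => z; rewrite !inE; apply/orP/orP => -[/eqP->|]; try by right.
- by case: (eqVneq z y) => [->|zy xz]; [left | right];
     rewrite // (red_trans yx xz) // eq_sym.
by case: (eqVneq z x) => [->|zx yz]; [left | right];
   rewrite // (red_trans xy yz) // eq_sym.
Qed.

Let root_rel (u v : {set G} + {set G}) := match u, v with
  | inl A, inr B => [exists x, (A == blue_class x) && (B == red_class x)]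
  | _, _ => false end.
Let root : sgraph := graph_of root_rel.

Let root_adj x : @adj root (inl (blue_class x)) (inr (red_class x)).
Proof.
rewrite /= orbF; apply/existsP; exists x.
by rewrite !eqxx.
Qed.

Let root_edge x : edge root := edge_of (root_adj x).

Let root_edge_inj x y :
  blue_class x == blue_class y -> red_class x == red_class y -> x = y.
Proof.
move=> /blue_classP[//|mxy] /red_classP[//|/andP[_]].
by rewrite mxy.
Qed.

Let root_edgeE x y : (val (root_edge x) == val (root_edge y)) = (x == y).
Proof.
apply/eqP/eqP => [|->//] /set2_inj[[[/eqP E] [/eqP E']]|[//]].
exact: root_edge_inj.
Qed.

Let root_edge_surj (e : edge root) : exists x, root_edge x = e.
Proof.
have [u [v [uv E]]] := edge_ends e.
case: u v uv E => [A|A] [B|B] /=; rewrite ?andbF ?orbF //.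
  case/existsP=> x /andP[/eqP-> /eqP->] E.
  by exists x; apply: val_inj; apply: esym E.
case/existsP=> x /andP[/eqP-> /eqP->] E.
by exists x; apply: val_inj; rewrite [RHS]E setUC.
Qed.

Let root_incidence : incidence_graph root.
Proof.
pose X := [set u : root | if (u : {set G} + {set G}) is inl _ then true else false].
exists X, (~: X); split; first split.
- exact: setUCr.
- by rewrite disjoints_subset setCK.
- by move=> [A|A] [B|B]; rewrite !inE //= andbF.
- by move=> [A|A] [B|B]; rewrite !inE //= andbF.
move=> [A|A]; rewrite !inE // => _; rewrite /degree.
have [/existsP[x /eqP Ex]|/existsP noA] := boolP [exists x, A == blue_class x];
  last first.
  rewrite (_ : neighbours _ = set0) ?cards0 //.
  apply/setP => -[B|B]; rewrite !inE /= ?andbF ?orbF //.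
  by apply/negbTE/existsP => -[y /andP[Ay _]]; apply: noA; exists y.
apply: leq_trans (card_setU1_le2 (@mat x)).
apply: leq_trans (leq_imset_card (fun y => inr (red_class y) : root) _).
apply/subset_leq_card/subsetP => -[B|B]; rewrite inE /= ?andbF ?orbF //.
case/existsP=> y /andP[/eqP E /eqP->]; apply: imset_f; rewrite inE.
by move: E; rewrite Ex => /eqP/blue_classP[->|->]; rewrite ?eqxx ?orbT.
Qed.

Lemma red_transitive_line : line_of_incidence G.
Proof.
exists root; first exact: root_incidence.
exists root_edge.
  apply: inj_surj_bij root_edge_surj => x y E; apply/eqP.
  by rewrite -root_edgeE E.
move=> x y; rewrite /= -[root_edge x == _]val_eqE root_edgeE.
have [->|nxy] := eqVneq x y; first by rewrite adj_irr.
rewrite /=; apply/set0Pn/idP => [[u]|xy].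
  rewrite !inE => /andP[/orP[]/eqP-> /orP[]] //.
  - rewrite (inj_eq inl_inj) => /blue_classP[E|/sub //].
    by rewrite E eqxx in nxy.
  - rewrite (inj_eq inr_inj) => /red_classP[E|/andP[]//].
    by rewrite E eqxx in nxy.
have [mxy|nmxy] := boolP (m x y).
  exists (inl (blue_class x)); rewrite !inE eqxx /=.
  by rewrite (inj_eq inl_inj) (introT (blue_classP x y)) //; right.
exists (inr (red_class x)); rewrite !inE eqxx /= (inj_eq inr_inj).
by rewrite (introT (red_classP x y)) //; right; rewrite /red xy.
Qed.

End RedTransitive.

Lemma connected_diamond (G : sgraph) (a b c d : G) : connected G ->
  diamond_at a b c d -> (forall v, ~~ adjacent_outside v a b c d) ->
  graph_iso G diamond.
Proof.
move=> conn D out; apply: (diamond_iso D) => x.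
apply: (conn (mem [:: a; b; c; d]) _ a x); last by rewrite /= mem_head.
move=> u v uv /=; rewrite !inE => ud; apply: contraT; rewrite !negb_or.
case/and4P=> va vb vc vd; case/negP: (out v); rewrite /adjacent_outside va vb vc vd /=.
by case/or4P: ud => /eqP <-; rewrite [adj v u]adj_sym uv ?orbT.
Qed.

Lemma good_connected (G : sgraph) (m : rel G) : connected G -> good m ->
  line_of_incidence G \/ graph_iso G diamond.
Proof.
move=> conn gm; have [sym sub mat P3] := gm.
pose m' x y := m x y && [exists z, adj y z && far x z || adj x z && far y z].
have gm' : good m'.
  split=> [x y|x y /andP[/sub]//|x y z /andP[xy _] /andP[xz _]|x y z xy yz xz].
  - by rewrite /m' sym; congr (_ && _); apply: eq_existsb => z; rewrite orbC.
  - exact: mat xy xz.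
  have := P3 x y z xy yz xz; rewrite /m' => /orP[->|->]; apply/orP; [left|right].
    by apply/existsP; exists z; rewrite yz xz.
  by apply/existsP; exists x; rewrite [adj y x]adj_sym xy [far z x]far_sym xz orbT.
have [sym' _ mat' P3'] := gm'.
pose red x y := adj x y && ~~ m' x y.
have red_sym x y : red x y = red y x by rewrite /red adj_sym sym'.
have [|/forallPn[x /forallPn[y /forallPn[z]]]] :=
  boolP [forall x, forall y, forall z, [&& red x y, red y z & x != z] ==> red x z].
  move=> /forallP tr; left; apply: (red_transitive_line gm') => x y z xy yz xz.
  have /forallP/(_ y)/forallP/(_ z)/implyP := tr x; apply.
  by apply/and3P.
rewrite negb_imply => /andP[/and3P[xy yz nxz] nxz']; right.
have isolated x1 y1 z1 w : red x1 y1 -> red y1 z1 -> m' x1 z1 -> adj z1 w ->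
    far x1 w -> graph_iso G diamond.
  move=> /andP[xy1 _] /andP[yz1 nyz] mxz zw xw.
  have nzw : ~~ m' z1 w.
    by apply/negP => mzw; case/andP: xw => /eqP[]; apply: mat' mzw; rewrite sym'.
  have yw : adj y1 w.
    have [E|//] : y1 = w \/ adj y1 w.
      apply/farPn/negP => /(P3' _ _ _ yz1 zw).
      by rewrite (negbTE nyz) (negbTE nzw).
    by case: (adj_far xy1); rewrite E.
  have D : diamond_at x1 w y1 z1.
    have /andP[/sub xz1 _] := mxz.
    by rewrite /diamond_at xw yz1 xy1 xz1 [adj w y1]adj_sym yw [adj w z1]adj_sym.
  exact: connected_diamond conn D (fun v => good_outside_diamond v gm D).
have mxz : m' x z.
  have [/andP[axy nxy] /andP[ayz nyz]] := (xy, yz).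
  have [a|na] := boolP (adj x z); first by move: nxz'; rewrite /red a negbK.
  have := P3' x y z axy ayz; rewrite (negbTE nxy) (negbTE nyz) /far nxz na.
  by move/(_ isT).
have /andP[_ /existsP[w /orP[]/andP[]]] := mxz; first exact: isolated xy yz mxz.
move=> xw zw; apply: (isolated z y x w) => //; first by rewrite red_sym.
  by rewrite red_sym.
by rewrite sym'.
Qed.

Lemma line_of_incidence_good (G : sgraph) :
  line_of_incidence G -> exists m : rel G, good m.
Proof.
case=> H [X [Y [[XY dXY iX iY] degX]]] [f bf mono].
have /fin_all_exists[p pP] : forall x : G, exists p : H * H,
    [/\ p.1 \in X, p.2 \in Y, adj p.1 p.2 & val (f x) = [set p.1; p.2]].
  move=> x; have [u [v [uv E]]] := edge_ends (f x).
  have inXY w : (w \in X) || (w \in Y) by rewrite -in_setU XY inE.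
  have [uX|uX] := boolP (u \in X).
    exists (u, v); split=> //; have := inXY v.
    by have [vX|//] := boolP (v \in X); have := iX u v uX vX; rewrite uv.
  exists (v, u); split=> //=; last by rewrite setUC.
  - have uY : u \in Y by have := inXY u; rewrite (negbTE uX).
    have := inXY v; have [vY|//] := boolP (v \in Y); last by rewrite orbF.
    by have := iY u v uY vY; rewrite uv.
  - by have := inXY u; rewrite (negbTE uX).
  by rewrite adj_sym.
have inj x y : (p x).1 = (p y).1 -> (p x).2 = (p y).2 -> x = y.
  move=> E1 E2; apply: (bij_inj bf); apply: val_inj.
  by have [_ _ _ ->] := pP x; have [_ _ _ ->] := pP y; rewrite E1 E2.
have disj u v : u \in X -> v \in Y -> u != v.
  by move=> uX; apply: contraTneq => <-; rewrite (disjointFr dXY uX).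
have adjE x y : adj x y = (x != y) && (((p x).1 == (p y).1) || ((p x).2 == (p y).2)).
  rewrite -mono /= (inj_eq (bij_inj bf)); congr (_ && _).
  have [[x1 x2 _ ->] [y1 y2 _ ->]] := (pP x, pP y).
  apply/set0Pn/orP => [[u]|[/eqP E|/eqP E]].
  - rewrite !inE => /andP[/orP[]/eqP-> /orP[]]; auto.
    + by rewrite (negbTE (disj _ _ x1 y2)).
    + by rewrite eq_sym (negbTE (disj _ _ y1 x2)).
  - by exists (p x).1; rewrite !inE E eqxx.
  by exists (p x).2; rewrite !inE E eqxx !orbT.
exists (fun x y => (x != y) && ((p x).1 == (p y).1)); split=> [x y|x y|x y z|x y z].
- by rewrite eq_sym [_.1 == _]eq_sym.
- by rewrite adjE => /andP[-> ->].
- move=> /andP[xy /eqP Exy] /andP[xz /eqP Exz]; apply/eqP/contraT => yz.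
  have [px _ _ _] := pP x.
  have : #|[set (p x).2; (p y).2; (p z).2]| <= degree (p x).1.
    apply/subset_leq_card/subsetP => u; rewrite !inE => /orP[/orP[]|]/eqP->.
    + by have [] := pP x.
    + by rewrite Exy; have [] := pP y.
    + by rewrite Exz; have [] := pP z.
  rewrite leqNgt; case/negP; apply: leq_ltn_trans (degX _ px) _.
  rewrite -setUA cardsU1 cards2 !inE negb_or.
  have N u v : u != v -> (p u).1 = (p v).1 -> (p u).2 != (p v).2.
    by move=> uv E; apply: contraNneq uv => E'; rewrite (inj u v).
  by rewrite (N x y) // (N x z) // (N y z) // -Exy.
rewrite !adjE /far adjE => /andP[-> /orP[->//|/eqP E]] /andP[-> /orP[->|/eqP E']].
  by rewrite orbT.
by rewrite E E' eqxx orbT andbT andbN.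
Qed.

Lemma iso_good (G H : sgraph) (m : rel H) :
  graph_iso G H -> good m -> exists m' : rel G, good m'.
Proof.
case=> f bf mono gm; exists (fun x y => m (f x) (f y)).
by apply: good_embedding gm; split=> //; exact: bij_inj.
Qed.

Lemma free_connected_good (G : sgraph) : connected G -> free forbidden G ->
  exists m : rel G, good m.
Proof.
move=> conn fr.
have [/existsP[a /existsP[b /existsP[c /existsP[d D]]]]|/existsPn no] :=
  boolP [exists a : G, exists b, exists c, exists d, diamond_at a b c d].
  have [m gm] := good_diamond_graph; apply: iso_good gm.
  exact: connected_diamond conn D (fun v => free_outside_diamond fr v D).
apply: free_no_diamond_good => // a b c d; apply: contra (no a) => D.
by apply/existsP; exists b; apply/existsP; exists c; apply/existsP; exists d.
Qed.

Theorem proposition17 (G : sgraph) :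
  [<-> has_free_colouring (fun P => [\/ P = bP3, P = rP3, P = bK3 | P = rbbK3]) G;
       has_free_colouring (fun P => [\/ P = bP3, P = rP3, P = rK3 | P = rrbK3]) G;
       forall C : {set G}, C \in components G ->
         line_of_incidence (induced C) \/ graph_iso (induced C) diamond;
       free forbidden G].
Proof.
have blue := has_free_colouring_good Blue G.
have red := has_free_colouring_good Red G.
tfae.
- by move/blue/red.
- move/red=> [m gm] C CC.
  apply: good_connected (connected_component CC) (good_embedding _ gm).
  exact: val_embedding.
- move=> lines; have [m gm] : exists m : rel G, good m.
    apply: good_components => C /lines[/line_of_incidence_good //|iso].
    by have [m gm] := good_diamond_graph; apply: iso_good gm.
  exact: good_free gm.
move=> fr; apply/blue/good_components => C CC.
apply: free_connected_good (connected_component CC) _.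
exact: free_embedding (@val_embedding _ _) fr.
Qed.
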